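(* Let $X$ be a compact metric space, $f:X\to X$ a continuous transformation, $\phi:X\to\mathbb R$ a continuous potential, and $\mu$ an $f$-invariant and ergodic probability measure. Then $$P_\mu(f,\phi)=\lim_{\varepsilon\to 0}\limsup_{n\to\infty}\frac1n\log\Big[e^{S_n\phi(B(x,n,\varepsilon))}\,R_n(x,\varepsilon)\Big]\quad\text{for $\mu$-almost every } x\in X.$$
   Context: For $x\in X$, $n\ge 1$, $\varepsilon>0$ the dynamical ball is $B(x,n,\varepsilon)=\{y\in X: d(f^j(x),f^j(y))<\varepsilon\text{ for every }0\le j\le n-1\}$. The $n$th return time to the dynamical ball is $R_n(x,\varepsilon)=\inf\{k\ge 1: f^k(x)\in B(x,n,\varepsilon)\}$. Moreover $S_n\phi(B(x,n,\varepsilon))=\sup\{\sum_{j=0}^{n-1}\phi(f^j(y)): y\in B(x,n,\varepsilon)\}$. The metric pressure of $\mu$ with respect to $f$ and $\phi$ is $P_\mu(f,\phi)=h_\mu(f)+\int\phi\,d\mu$, where $h_\mu(f)$ is the metric entropy. *)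

(* Defs.v *)
From HB Require Import structures.
From mathcomp Require Export all_boot all_order all_algebra.
From mathcomp Require Export all_classical all_reals all_analysis.

Set Implicit Arguments.
Unset Strict Implicit.
Unset Printing Implicit Defensive.

Export Order.TTheory GRing.Theory Num.Theory.
Export numFieldNormedType.Exports.

Local Open Scope classical_set_scope.
Local Open Scope ring_scope.

(* [measurableType] is pointed by construction.  A space carrying a
   probability measure is nonempty, so the base point is no restriction. *)
#[short(type="pointedMetricType")]
HB.structure Definition PointedMetric (K : numDomainType) :=
  {M of Metric K M & Pointed M}.

Notation borel X := (g_sigma_algebraType (@open X)).

Section ergodic_theory.
Context {d : measure_display} {T : measurableType d} {R : realType}.
Variables (mu : probability T R) (f : T -> T).

Definition invariant_measure :=
  forall A, measurable A -> pushforward mu f A = mu A.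

Definition ergodic :=
  forall A, measurable A -> f @^-1` A = A -> mu A = 0%E \/ mu A = 1%E.

(* The product convention 0 * log 0 = 0 holds since [ln 0] is a real number. *)
Definition partition_entropy (I : finType) (P : I -> set T) : R :=
  - \sum_(i : I) fine (mu (P i)) * ln (fine (mu (P i))).

(* The join of the preimages f^{-j} P for j < n.  Its blocks are indexed by
   the itineraries w; those of itineraries that do not occur are empty and
   contribute 0 to the entropy. *)
Definition iterated_join (I : finType) (P : I -> set T) (n : nat)
    (w : {ffun 'I_n -> I}) : set T :=
  \bigcap_(j in [set: 'I_n]) iter j f @^-1` P (w j).

Definition entropy_wrt (I : finType) (P : I -> set T) : \bar R :=
  limn (fun n => (n%:R^-1 * partition_entropy (iterated_join P (n := n)))%:E).

Definition metric_entropy : \bar R :=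
  ereal_sup [set h | exists k (P : 'I_k -> set T),
    [/\ partition setT P setT, forall i, measurable (P i)
      & h = entropy_wrt P]].

Definition metric_pressure (phi : T -> R) : \bar R :=
  (metric_entropy + \int[mu]_x (phi x)%:E)%E.

End ergodic_theory.

Section dynamical_balls.
Context {R : realType} {X : metricType R}.
Variable f : X -> X.

Definition dynamical_ball (x : X) (n : nat) (eps : R) : set X :=
  [set y | forall j, (j < n)%N -> mdist (iter j f x) (iter j f y) < eps].

(* The infimum is +oo when the orbit never returns. *)
Definition return_time (n : nat) (x : X) (eps : R) : \bar R :=
  ereal_inf [set k%:R%:E | k in
    [set k : nat | (1 <= k)%N /\ dynamical_ball x n eps (iter k f x)]].

Definition birkhoff_sum (phi : X -> R) (n : nat) (y : X) : R :=
  \sum_(j < n) phi (iter j f y).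

Definition birkhoff_sum_sup (phi : X -> R) (n : nat) (B : set X) : \bar R :=
  ereal_sup [set (birkhoff_sum phi n y)%:E | y in B].

End dynamical_balls.

(* Main.v *)
From mathcomp Require Import finmap measurable_realfun lra ring zify.
Require Import Defs.

(** Write [S_n] for the Birkhoff sum of [phi] and [R_n] for the return time to
    the dynamical ball. By uniform continuity, [S_n] varies over a dynamical
    ball of small radius by a small multiple of [n], and at the centre it is
    asymptotic to [n] times the integral of [phi], by the ergodic theorem
    ([birkhoff_eventually], a maximal inequality). It remains to see that the
    upper exponential growth rate of [R_n] tends to the entropy as the radius
    of the ball tends to [0].

    The entropy of a finite labelling [p] enters only through the rates [c] for
    which [p] is [codable]: typical words of length [n], one of which a typical
    point has at every large [n], number at most [expR (c * n)]. A block code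
    ([word_entropy_codable]) makes every [c] above one of the normalized block
    entropies such a rate, and a rate bounds the later normalized block
    entropies ([codable_word_entropy_le]). Hence these converge to their
    infimum, which is also the infimum of the rates ([word_entropy_rate]).

    Upper bound ([return_time_upper]). Take a partition into sets smaller than
    the radius, so that a point is back in its ball when its word recurs. The
    points of a set that do not return to it within [L] steps have measure at
    most [1 / L.+1], because their preimages of order at most [L] are disjoint
    ([measure_no_return_le]). Summed over at most [expR (c * n)] typical words,
    this leaves a summable measure for no recurrence by time
    [expR (c' * n)], for every [c' > c].

    Lower bound ([return_time_lower]). Suppose that most points return to their
    ball of length [b] within [expR (c * b)] steps. Cut a long orbit into blocks
    of length [b] and record, for each block, its return time: this costs [c]
    per unit of time, and it determines the labels from right to left, each
    label being copied from a later position ([codable_of_returns]). So, up to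
    a small error, the entropy of the labelling is at most [c]. A return is only
    approximate, and errors would add up along the copies. Therefore the copied
    labels are those of an approximation that is locally constant at the scale
    of the ball off a set [W] of small measure
    ([labelling_stable_approximation]), and labels are written down explicitly
    at the rare visits to [W]. *)

Set Implicit Arguments.
Unset Strict Implicit.
Unset Printing Implicit Defensive.

Local Open Scope classical_set_scope.
Local Open Scope ring_scope.

(** * Probability measures and sets invariant under the dynamics *)

Section probability_facts.
Context {d} {T : measurableType d} {R : realType} (mu : probability T R).

Lemma probability_fineK A : measurable A -> (fine (mu A))%:E = mu A.
Proof. by move=> mA; rewrite fineK// fin_num_measure. Qed.

Lemma measurable_set_bool (b : T -> bool) :
  measurable_fun [set: T] b -> measurable [set x | b x].
Proof.
by move=> /(_ measurableT [set true]); rewrite setTI preimage_true; exact.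
Qed.

Lemma ae_measure1 A : measurable A -> mu A = 1%E -> {ae mu, forall x, A x}.
Proof.
move=> mA A1; exists (~` A); split => //; first exact: measurableC.
by rewrite probability_setC// A1 subee.
Qed.

Lemma ae_measure0 A : measurable A -> mu A = 0%E -> {ae mu, forall x, ~ A x}.
Proof. by move=> mA A0; exists A; split => // x /contrapT. Qed.

(** Continuity of the measure along the decreasing sets of points that are
    outside some later [A n]. *)
Lemma ae_eventually_measureC (A : nat -> set T) (e : R) : 0 < e ->
  (forall n, measurable (A n)) ->
  {ae mu, forall x, \forall n \near \oo, A n x} ->
  \forall n \near \oo, fine (mu (~` A n)) < e.
Proof.
move=> e0 mA aeA; have mAC n : measurable (~` A n) by exact: measurableC.
have mU n : measurable (\bigcup_(k >= n) ~` A k) by exact: bigcup_measurable.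
have lim0 : mu (lim_sup_set (fun n => ~` A n)) = 0%E.
  apply/negligibleP; first by apply: bigcapT_measurable => n; exact: mU.
  apply: negligibleS aeA => x lx [N _ NA].
  by have [k /= Nk] := lx N I; apply; exact: NA.
have c : mu (\bigcup_(k >= n) ~` A k) @[n --> \oo] --> 0%E.
  rewrite -lim0; apply: lim_sup_set_cvg => //.
  by rewrite (le_lt_trans (probability_le1 mu (mU 0%N)))// ltry.
have : \forall n \near \oo, (mu (\bigcup_(k >= n) ~` A k) < e%:E)%E.
  by apply: (c [set y | (y < e%:E)%E]); apply: open_ereal_lt'; rewrite lte_fin.
apply: filterS => n; rewrite -lte_fin probability_fineK//; apply: le_lt_trans.
by apply: le_measure; rewrite ?inE// => x Ax; exists n => /=.
Qed.

End probability_facts.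

Section measure_preserving.
Context {d} {T : measurableType d} {R : realType}.
Variables (mu : probability T R) (f : T -> T).
Hypotheses (mf : measurable_fun [set: T] f) (finv : invariant_measure mu f).

Lemma measurable_iter n : measurable_fun [set: T] (iter n f).
Proof.
elim: n => [|n IHn]; first exact: measurable_id.
exact: (measurableT_comp mf IHn).
Qed.

Lemma measurable_preimage_iter n A :
  measurable A -> measurable (iter n f @^-1` A).
Proof. by move=> mA; rewrite -[_ @^-1` _]setTI; exact: measurable_iter. Qed.

Lemma measure_preimage_iter n A :
  measurable A -> mu (iter n f @^-1` A) = mu A.
Proof.
move=> mA; elim: n => [//|n IHn]; rewrite -[in RHS]IHn.
rewrite -[RHS](finv (measurable_preimage_iter n mA)); congr (mu _).
by apply/seteqP; split=> x /=; rewrite -iterSr.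
Qed.

Lemma ae_iter (P : T -> Prop) : {ae mu, forall x, P x} ->
  {ae mu, forall x, forall n, P (iter n f x)}.
Proof.
case=> A [mA A0 PA]; apply: ae_foralln => n.
exists (iter n f @^-1` A); split; first exact: measurable_preimage_iter.
  exact: etrans (measure_preimage_iter n mA) A0.
by move=> x /= nP; exact: PA.
Qed.

(** The increasing union of the preimages of [A] is strictly invariant and,
    since [f] preserves the measure, no larger than [A]. *)
Lemma ergodic_sub_preimage A : ergodic mu f -> measurable A ->
  A `<=` f @^-1` A -> mu A = 0%E \/ mu A = 1%E.
Proof.
move=> ferg mA Af; pose B := \bigcup_n (iter n f @^-1` A).
have mB : measurable B.
  by apply: bigcupT_measurable => n; exact: measurable_preimage_iter.
have Binv : f @^-1` B = B.
  apply/seteqP; split=> x [n _ /= Anx]; last first.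
    by exists n => //=; rewrite -iterSr; exact: Af.
  by exists n.+1 => //=; rewrite -/(iter n.+1 f x) iterSr.
have cB : mu \o (fun n => iter n f @^-1` A) @ \oo --> mu B.
  apply: nondecreasing_cvg_mu => //.
    by move=> n; exact: measurable_preimage_iter.
  apply/nondecreasing_seqP => n; apply/subsetPset => x /= /Af.
  by [].
suff -> : mu A = mu B by exact: ferg.
apply/esym/(cvg_unique _ cB) => //; apply: cvg_near_cst; apply: nearW => n /=.
by rewrite measure_preimage_iter.
Qed.

End measure_preserving.

(** * One half of the ergodic theorem *)

Section birkhoff.
Context {d} {T : measurableType d} {R : realType}.
Variables (mu : probability T R) (f : T -> T).
Hypotheses (mf : measurable_fun [set: T] f) (finv : invariant_measure mu f).

Lemma integrable_bounded (g : T -> R) (M : R) : measurable_fun [set: T] g ->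
  (forall x, `|g x| <= M) -> mu.-integrable [set: T] (EFin \o g).
Proof.
move=> mg gM; apply: measurable_bounded_integrable => //.
  by rewrite (le_lt_trans (probability_le1 mu _))// ltry.
exists M; split; first by rewrite num_real.
by move=> y /ltW My x _; exact: le_trans My.
Qed.

Lemma Rintegral_invariant (g : T -> R) (M : R) : measurable_fun [set: T] g ->
  (forall x, `|g x| <= M) -> \int[mu]_x g (f x) = \int[mu]_x g x.
Proof.
move=> mg gM; rewrite /Rintegral; congr fine.
transitivity (\int[pushforward mu f]_x (g x)%:E)%E; last first.
  by apply: eq_measure_integral => A mA _; exact: finv.
rewrite integral_pushforward//; first exact/measurable_EFinP.
apply: (integrable_bounded (M := M)); last by [].
exact: (measurableT_comp mg mf).
Qed.

(** [max (S_0, ..., S_n)], where [S_k] is the Birkhoff sum of [h] of length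
    [k]: the largest sum over a possibly empty initial segment of the orbit. *)
Fixpoint max_birkhoff (h : T -> R) n (x : T) : R :=
  if n is n'.+1 then Num.max 0 (h x + max_birkhoff h n' (f x)) else 0.

Lemma max_birkhoff_ge0 h n x : 0 <= max_birkhoff h n x.
Proof. by case: n => [//|n] /=; rewrite le_max lexx. Qed.

Lemma max_birkhoffS h n x : max_birkhoff h n x <= max_birkhoff h n.+1 x.
Proof.
elim: n x => [|n IHn] x; first exact: max_birkhoff_ge0.
rewrite [leLHS]/= [leRHS]/= ge_max le_max lexx/= le_max lerD2l.
by rewrite IHn orbT.
Qed.

Lemma le_max_birkhoff h k n x : (k <= n)%N ->
  \sum_(j < k) h (iter j f x) <= max_birkhoff h n x.
Proof.
elim: n k x => [|n IHn] [|k] x // kn; rewrite ?big_ord0 ?max_birkhoff_ge0//.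
rewrite big_ord_recl le_max; apply/orP; right; rewrite lerD2l.
by under eq_bigr do rewrite lift0 iterSr; exact: IHn.
Qed.

Lemma measurable_max_birkhoff h n : measurable_fun [set: T] h ->
  measurable_fun [set: T] (max_birkhoff h n).
Proof.
move=> mh; elim: n => [|n IHn]; first exact: measurable_cst.
apply: measurable_maxr; first exact: measurable_cst.
by apply: measurable_funD => //; exact: (measurableT_comp IHn mf).
Qed.

Lemma max_birkhoff_bounded h (C : R) n x : (forall x, `|h x| <= C) ->
  `|max_birkhoff h n x| <= C *+ n.
Proof.
move=> hC; rewrite ger0_norm ?max_birkhoff_ge0//.
have C0 : 0 <= C by exact: le_trans (normr_ge0 _) (hC x).
elim: n x => [//|n IHn] x /=; rewrite ge_max mulrn_wge0//= mulrS lerD//.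
exact: le_trans (ler_norm _) (hC x).
Qed.

(** Garsia's argument: where [max_birkhoff h n.+1] is positive, it is [h x] plus
    [max_birkhoff h n] at [f x]; elsewhere it vanishes, and the indicator makes
    up for the sign of [h x]. *)
Lemma max_birkhoff_le h (C : R) n x : (forall x, `|h x| <= C) ->
  max_birkhoff h n.+1 x - max_birkhoff h n.+1 (f x) <=
  h x + C * \1_[set y | max_birkhoff h n.+1 y <= 0] x.
Proof.
move=> hC; rewrite indicE; case: (leP (max_birkhoff h n.+1 x) 0) => M0.
  rewrite mem_set// mulr1 (@le_trans _ _ 0)//.
    by rewrite subr_le0 (le_trans M0)// max_birkhoff_ge0.
  by rewrite -lerBlDl sub0r (le_trans _ (hC x))// -normrN ler_norm.
rewrite memNset ?mulr0 ?addr0; last by move=> /=; rewrite leNgt M0.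
rewrite lerBlDr; move: M0; rewrite [X in 0 < X -> _]/= lt_max ltxx/= => M0.
by rewrite (max_r (ltW M0)) lerD2l; exact: (max_birkhoffS h n (f x)).
Qed.

(** Integrate [max_birkhoff_le]: the left-hand sides have integral zero, and the
    sets where no Birkhoff sum up to length [n] is positive decrease to a null
    set. *)
Lemma Rintegral_ge0_of_birkhoff_gt0 (h : T -> R) C :
  measurable_fun [set: T] h ->
  (forall x, `|h x| <= C) ->
  {ae mu, forall x, exists n, 0 < \sum_(j < n) h (iter j f x)} ->
  0 <= \int[mu]_x h x.
Proof.
move=> mh hC h0; have C0 : 0 <= C by exact: le_trans (normr_ge0 _) (hC point).
pose E n := [set y | max_birkhoff h n y <= 0].
have mM := fun n => @measurable_max_birkhoff h n mh.
have mE n : measurable (E n).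
  apply: measurable_set_bool.
  apply: measurable_fun_ler; [exact: mM|exact: measurable_cst].
have leE n : - (C * fine (mu (E n.+1))) <= \int[mu]_x h x.
  have MC := @max_birkhoff_bounded h (C : R) n.+1 ^~ hC.
  have iM := integrable_bounded (mM n.+1) MC.
  have ih := integrable_bounded mh hC.
  have iMf : mu.-integrable [set: T] (EFin \o (max_birkhoff h n.+1 \o f)).
    apply: (integrable_bounded (M := C *+ n.+1)) => [|x]; last exact: MC.
    exact: (measurableT_comp (mM _) mf).
  have iE : mu.-integrable [set: T] (EFin \o (\1_(E n.+1) : T -> R)).
    apply: (integrable_bounded (M := 1)) => [|x]; first exact: measurable_indic.
    by rewrite indicE; case: (_ \in _); rewrite ?normr1 ?normr0.
  have : \int[mu]_x (max_birkhoff h n.+1 x - max_birkhoff h n.+1 (f x)) <=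
         \int[mu]_x (h x + C * \1_(E n.+1) x).
    apply: le_Rintegral => //.
    - exact: (integrableB _ iM iMf).
    - exact: (integrableD _ ih (integrableZl measurableT C iE)).
    - by move=> x _; exact: max_birkhoff_le.
  rewrite RintegralB// (Rintegral_invariant (mM n.+1) MC) subrr.
  rewrite RintegralD//; last exact: (integrableZl measurableT C iE).
  rewrite RintegralZl// /Rintegral integral_indic// setIT => ?.
  by rewrite -subr_ge0 opprK.
rewrite leNgt; apply/negP => hlt.
have e0 : 0 < - (\int[mu]_x h x) / (C + 1).
  by rewrite divr_gt0 ?oppr_gt0// ltr_wpDl.
have : \forall n \near \oo,
    fine (mu (~` (~` E n))) < - (\int[mu]_x h x) / (C + 1).
  apply: ae_eventually_measureC => //; first by move=> n; exact: measurableC.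
  apply: filterS h0 => x [k hk]; exists k => // n /= kn.
  rewrite /E /=; apply/negP; rewrite -ltNge; apply: lt_le_trans hk _.
  exact: le_max_birkhoff.
case=> N _ /(_ N.+1 (leqnSn N)) /=; rewrite setCK ltr_pdivlMr ?ltr_wpDl//.
rewrite ltrNr; apply/negP; rewrite -leNgt; apply: le_trans (leE N).
by rewrite lerN2 mulrC ler_wpM2l ?lerDl// fine_ge0.
Qed.

(** One half of the ergodic theorem: apply the maximal inequality to [g - c]
    on the strictly invariant set where its Birkhoff sums are unbounded. *)
Lemma birkhoff_le (g : T -> R) (M c : R) : ergodic mu f ->
  measurable_fun [set: T] g -> (forall x, `|g x| <= M) ->
  \int[mu]_x g x < c ->
  {ae mu, forall x, exists K, forall n,
    \sum_(j < n) g (iter j f x) <= c * n%:R + K}.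
Proof.
move=> ferg mg gM gc; pose h x := g x - c.
have mh : measurable_fun [set: T] h by apply: measurable_funB => //.
pose S n x := \sum_(j < n) h (iter j f x).
have mS n : measurable_fun [set: T] (S n).
  apply: measurable_sum => j; apply: (measurableT_comp mh).
  exact: measurable_iter.
have SE n x : S n x = \sum_(j < n) g (iter j f x) - c * n%:R.
  by rewrite /S /h sumrB sumr_const card_ord mulr_natr.
pose A := \bigcap_K \bigcup_n [set x | K%:R < S n x].
have mA : measurable A.
  apply: bigcapT_measurable => K; apply: bigcupT_measurable => n.
  apply: measurable_set_bool.
  apply: measurable_fun_ltr; [exact: measurable_cst|exact: mS].
have AP x : A x <-> forall K : R, exists n, K < S n x.
  split=> [Ax K|Ax K _]; last by have [n] := Ax K%:R; exists n.
  have [n _ /= nK] := Ax (Num.truncn `|K|).+1 I; exists n.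
  by apply: lt_trans nK; rewrite (le_lt_trans (ler_norm K))// truncnS_gt.
have Ainv : f @^-1` A = A.
  apply/seteqP; split=> x; rewrite /preimage /= => /AP Ax; apply/AP => K.
    have [n] := Ax (K - h x); exists n.+1.
    rewrite /S big_ord_recl -ltrBlDl; under eq_bigr do rewrite lift0 iterSr.
    by [].
  have [[|n]] := Ax (Num.max 0 (K + h x)).
    by rewrite /S big_ord0 gt_max ltxx.
  rewrite gt_max => /andP[_]; rewrite /S big_ord_recl addrC ltrD2l => Kn.
  by exists n; under eq_bigr do rewrite -iterSr.
have [A0|A1] := ferg _ mA Ainv.
  apply: filterS (ae_measure0 mA A0) => x Ax.
  apply: contrapT => nK; apply/Ax/AP => K; apply: contrapT => nn.
  apply: nK; exists K => n; rewrite -lerBlDl -SE leNgt.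
  by apply/negP => Kn; apply: nn; exists n.
suff : 0 <= \int[mu]_x h x.
  rewrite RintegralB//; first last.
  - by apply: (integrable_bounded (M := `|c|)) => // x.
  - exact: integrable_bounded gM.
  by rewrite Rintegral_cst//= probability_setT mulr1 subr_ge0 leNgt gc.
apply: (@Rintegral_ge0_of_birkhoff_gt0 h (M + `|c|)) => //.
  by move=> x; rewrite (le_trans (ler_normB _ _))// lerD2r.
by apply: filterS (ae_measure1 mA A1) => x /AP/(_ 0).
Qed.

Lemma birkhoff_eventually (g : T -> R) (M c : R) : ergodic mu f ->
  measurable_fun [set: T] g -> (forall x, `|g x| <= M) ->
  \int[mu]_x g x < c ->
  {ae mu, forall x, \forall n \near \oo,
    \sum_(j < n) g (iter j f x) <= c * n%:R}.
Proof.
move=> ferg mg gM gc; have [b /andP[gb bc]] : exists b, \int[mu]_x g x < b < c.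
  by exists (((\int[mu]_x g x) + c) / 2); rewrite midf_lt//= midf_lt.
apply: filterS (birkhoff_le ferg mg gM gb) => x [K SK].
near=> n; rewrite (le_trans (SK n))// -lerBrDl -mulrBl -ler_pdivrMl ?subr_gt0//.
near: n; exact: nbhs_infty_ger.
Unshelve. all: by end_near. Qed.

End birkhoff.

(** * Finite labellings and counting of words *)

Section labellings.
Context {d} {T : measurableType d} {R : realType} (mu : probability T R).

Definition measurable_labelling (I : finType) (p : T -> I) :=
  forall i, measurable (p @^-1` [set i]).

Lemma measurable_preimage_labelling (I : finType) (p : T -> I) (A : set I) :
  measurable_labelling p -> measurable (p @^-1` A).
Proof.
move=> mp; rewrite (_ : p @^-1` A = \bigcup_(i in A) (p @^-1` [set i])).
  apply: fin_bigcup_measurable => //; exact: (@sub_finite_set _ _ [set: I]).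
by apply/seteqP; split=> [x Ax|x [i Ai /= pxi]]; [exists (p x)|rewrite /= pxi].
Qed.

Lemma measurable_fun_labelling (I : finType) (p : T -> I) (g : I -> R) :
  measurable_labelling p -> measurable_fun [set: T] (g \o p).
Proof.
move=> mp _ B _; rewrite setTI comp_preimage.
exact: (measurable_preimage_labelling _ mp).
Qed.

Lemma normr_finite_le (I : finType) (g : I -> R) i : `|g i| <= \sum_j `|g j|.
Proof. by rewrite (bigD1 i)//= lerDl sumr_ge0. Qed.

Lemma Rintegral_labelling (I : finType) (p : T -> I) (g : I -> R) :
  measurable_labelling p ->
  \int[mu]_x g (p x) = \sum_i fine (mu (p @^-1` [set i])) * g i.
Proof.
move=> mp; rewrite /Rintegral.
transitivity (fine (\int[mu]_x \sum_i (g i * \1_(p @^-1` [set i]) x)%:E)%E).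
  congr fine; apply: eq_integral => x _; rewrite sumEFin; congr (_%:E).
  rewrite (bigD1 (p x))//= indicE mem_set// mulr1 big1 ?addr0// => i ip.
  by rewrite indicE memNset ?mulr0//= => /esym; apply/eqP.
have int1 i : mu.-integrable [set: T] (EFin \o (\1_(p @^-1` [set i]) : T -> R)).
  apply: (integrable_bounded mu (M := 1)) => [|x]; first exact: measurable_indic.
  by rewrite indicE; case: (_ \in _); rewrite ?normr1 ?normr0.
rewrite integral_sum//; last first.
  by move=> i; exact: (integrableZl measurableT (g i) (int1 i)).
have -> : \sum_i fine (mu (p @^-1` [set i])) * g i =
    fine (\sum_i (fine (mu (p @^-1` [set i])) * g i)%:E)%E.
  by rewrite sumEFin.
congr fine; apply: eq_bigr => i _.
rewrite mulrC EFinM probability_fineK// -[in RHS](setIT (p @^-1` _)).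
by rewrite -integral_indic// -(integralZl measurableT (int1 i)).
Qed.

Lemma sum_labelling (I : finType) (p : T -> I) : measurable_labelling p ->
  \sum_i fine (mu (p @^-1` [set i])) = 1.
Proof.
move=> mp; under eq_bigr do rewrite -[fine _]mulr1.
rewrite -(Rintegral_labelling (fun=> 1))// Rintegral_cst//= probability_setT.
by rewrite mulr1.
Qed.

Lemma measure_labelling (I : finType) (p : T -> I) (A : {set I}) :
  measurable_labelling p ->
  fine (mu (p @^-1` [set` A])) = \sum_(i in A) fine (mu (p @^-1` [set i])).
Proof.
move=> mp; transitivity (\int[mu]_x (p x \in A)%:R).
  rewrite /Rintegral; under eq_integral.
    move=> x _; rewrite (_ : (p x \in A)%:R = \1_(p @^-1` [set` A]) x); last first.
      rewrite indicE; congr (nat_of_bool _)%:R.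
      by apply/idP/idP; rewrite inE.
    over.
  by rewrite integral_indic ?setIT//; exact: measurable_preimage_labelling.
rewrite (Rintegral_labelling (fun i => (i \in A)%:R))//.
rewrite [RHS]big_mkcond; apply: eq_bigr => i _.
by case: ifP; rewrite ?mulr1 ?mulr0.
Qed.

End labellings.

Section counting.
Context {R : realType}.

(** Choose for every word a point that has it and a code valid for that point:
    this is an injection. Validity is a relation because the codes used below
    depend on choices made along the orbit. *)
Lemma card_words_le_codes (T : Type) (W C : finType) (w : T -> W)
    (good : T -> Prop) (A : {set C}) (valid : T -> C -> Prop) :
  (forall x, good x -> exists2 c, c \in A & valid x c) ->
  (forall x y c, valid x c -> valid y c -> w x = w y) ->
  (#|[set v : W | `[< exists2 x, good x & w x = v >]]%SET| <= #|A|)%N.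
Proof.
move=> good_valid valid_inj.
set S := (X in #|pred_of_set X|).
have [->|[v0 v0S]] := set_0Vmem S; first by rewrite cards0.
have witness v : v \in S -> exists xc : T * C,
    [/\ xc.2 \in A, valid xc.1 xc.2 & w xc.1 = v].
  by rewrite inE => /asboolP[x /good_valid[c cA xc] <-]; exists (x, c).
have [c0 _] : exists c0 : C, True by have [[? c] _] := witness _ v0S; exists c.
pose code v := if pselect (v \in S) is left vS then (sval (cid (witness v vS))).2
               else c0.
have inj : {in S &, injective code}.
  move=> u v uS vS; rewrite /code.
  case: pselect => // uS'; case: pselect => // vS'.
  case: cid => -[x c] /= [_ xc <-]; case: cid => -[y c'] /= [_ yc' <-] cc'.
  by apply: valid_inj xc _; rewrite cc'.
rewrite -(card_in_imset inj); apply/subset_leq_card/fintype.subsetP => c.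
move=> /imsetP[v vS ->].
by rewrite /code; case: pselect => // vS'; case: cid => -[? ?] /= [].
Qed.

(** The product weights of all words sum to one, by distributivity. *)
Lemma card_heavy_words (B : finType) (m : B -> R) k t :
  (forall b, 0 <= m b) -> \sum_b m b = 1 -> 0 < t ->
  #|[set b : {ffun 'I_k -> B} | t <= \prod_i m (b i)]%SET|%:R <= t^-1.
Proof.
move=> m0 m1 t0; rewrite -[t^-1]mul1r ler_pdivlMr//.
have sum1 : \sum_(b : {ffun 'I_k -> B}) \prod_i m (b i) = 1.
  by rewrite -(bigA_distr_bigA (fun _ => m)) big1.
rewrite -sumr_const mulr_suml -[leRHS]sum1.
rewrite [leRHS](bigID (mem [set b : {ffun 'I_k -> B} | t <= \prod_i m (b i)]%SET))/=.
rewrite ler_wpDr//; first by apply: sumr_ge0 => b _; exact: prodr_ge0.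
by apply: ler_sum => b; rewrite inE mul1r.
Qed.

(** One block less than [n %/ b] leaves room for an offset smaller than [b]. *)
Lemma block_bounds n b r : (r < b)%N -> (b <= n)%N ->
  (r + (n %/ b).-1 * b <= n)%N /\ (n <= r + (n %/ b).-1 * b + (b + b))%N.
Proof.
move=> rb bn; have b0 : (0 < b)%N by apply: leq_ltn_trans rb.
have := ltn_ceil n b0; have := leq_divM n b.
have : (b <= n %/ b * b)%N by rewrite leq_pmull// divn_gt0.
by rewrite -subn1 mulnBl mul1n mulSn; lia.
Qed.

Lemma block_position t r b : (0 < b)%N -> (r <= t)%N ->
  t = ((t - r) %% b + (r + (t - r) %/ b * b))%N.
Proof. by move=> b0 rt; have := divn_eq (t - r) b; lia. Qed.

(** The [N] progressions are disjoint and stay in [[0, n)], so that the least of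
    the sums along them is at most the average. *)
Lemma progression_le (a : nat -> R) N n s : (0 < N)%N -> (forall j, 0 <= a j) ->
  \sum_(j < n) a j <= N%:R * s ->
  exists r : 'I_N, \sum_(i < (n %/ N).-1) a (r + i * N)%N <= s.
Proof.
move=> N0 a0 an; apply: contrapT => /forallNP nr.
have : \sum_(r < N) s < \sum_(r < N) \sum_(i < (n %/ N).-1) a (r + i * N)%N.
  case: N N0 nr {an} => // N _ nr.
  rewrite big_ord_recl [ltRHS]big_ord_recl ltr_leD//.
    by rewrite ltNge; apply/negP/nr.
  by apply: ler_sum => r _; rewrite leNgt; apply/negP => /ltW; exact: nr.
apply/negP; rewrite -leNgt sumr_const card_ord -[leRHS]mulr_natl.
apply: le_trans an.
have -> : \sum_(r < N) \sum_(i < (n %/ N).-1) a (r + i * N)%N =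
          \sum_(j < (n %/ N).-1 * N) a j.
  elim: (n %/ N).-1 => [|k IHk].
    by rewrite big1 ?big_ord0// => r _; rewrite big_ord0.
  rewrite mulSnr big_split_ord/= -IHk -big_split/=; apply: eq_bigr => r _.
  by rewrite big_ord_recr/= addnC.
have kn : ((n %/ N).-1 * N <= n)%N.
  by rewrite (leq_trans _ (leq_divM n N))// leq_mul2r leq_pred orbT.
move: kn; move: (_ * _)%N => k kn.
by rewrite -(subnKC kn) big_split_ord/= lerDl sumr_ge0.
Qed.

(** The term of Gibbs' inequality, from [ln (q / p) <= q / p - 1]. *)
Lemma xlnx_le (p q : R) : 0 <= p -> 0 < q ->
  - (p * ln p) <= - (p * ln q) + q - p.
Proof.
rewrite le_eqVlt => /predU1P[<- q0|p0 q0].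
  by rewrite !mul0r oppr0 addr0 add0r ltW.
have : ln (q / p) <= q / p - 1.
  have := @le_ln1Dx _ (q / p - 1); rewrite addrCA subrr addr0; apply.
  by rewrite -subr_gt0 opprK subrK divr_gt0.
rewrite ln_div ?posrE// -(ler_pM2l p0) !mulrBr mulr1 mulrCA divff ?gt_eqF// mulr1.
lra.
Qed.

(** Gibbs' inequality against the weight that is [M^-1] on [G] and uniform on
    the other words; its total mass is at most [2]. *)
Lemma entropy_le_card (W : finType) (p : W -> R) (G : {set W}) M :
  (forall w, 0 <= p w) -> \sum_w p w = 1 -> 0 < M -> #|G|%:R <= M ->
  - \sum_w p w * ln (p w) <=
  ln M + (\sum_(w in ~: G) p w) * (ln (#|W|%:R) - ln M) + 2.
Proof.
move=> p0 p1 M0 GM; pose q w := if w \in G then M^-1 else #|W|%:R^-1.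
have W0 : 0 < (#|W|%:R : R).
  rewrite ltr0n lt0n; apply/eqP => /card0_eq W0.
  have : \sum_w p w = 0 by apply: big1 => w _; have := W0 w; rewrite inE.
  by rewrite p1 => /eqP; rewrite oner_eq0.
have q0 w : 0 < q w by rewrite /q; case: ifP; rewrite invr_gt0.
rewrite -sumrN; apply: le_trans.
  by apply: ler_sum => w _; exact: xlnx_le (p0 w) (q0 w).
rewrite !big_split/= [X in _ + X <= _]sumrN p1.
have -> : \sum_w - (p w * ln (q w)) =
    ln M + (\sum_(w in ~: G) p w) * (ln (#|W|%:R) - ln M).
  rewrite -[X in _ = X + _]mul1r -[X in _ = X * _ + _]p1 !mulr_suml.
  rewrite [X in _ = _ + X]big_mkcond/= -big_split/=.
  apply: eq_bigr => w _; rewrite inE /q; case: (w \in G) => /=;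
  rewrite lnV ?posrE//; ring.
have q2 : \sum_w q w <= 2.
  rewrite (bigID (mem G))/= (_ : 2 = 1 + 1)//; apply: lerD.
    rewrite (eq_bigr (fun=> M^-1)); last by move=> w wG; rewrite /q wG.
    by rewrite sumr_const -[X in X <= _]mulr_natl ler_pdivrMr// mul1r.
  rewrite (eq_bigr (fun=> #|W|%:R^-1)); last by move=> w /negbTE wG; rewrite /q wG.
  rewrite sumr_const -[X in X <= _]mulr_natl ler_pdivrMr// mul1r ler_nat.
  exact: max_card.
lra.
Qed.

Lemma near_expR_absorbs_constant (C b c : R) : b < c ->
  \forall n \near \oo, C * expR (b * n%:R) <= expR (c * n%:R).
Proof.
move=> bc; near=> n; have : `|C| <= expR ((c - b) * n%:R).
  rewrite (le_trans _ (expR_ge1Dx _))// -lerBlDl -ler_pdivrMl ?subr_gt0//.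
  near: n; exact: nbhs_infty_ger.
move=> Cn; rewrite (@le_trans _ _ (`|C| * expR (b * n%:R)))//.
  by rewrite ler_wpM2r ?expR_ge0// ler_norm.
rewrite (le_trans (ler_wpM2r _ Cn)) ?expR_ge0// -expRD.
by rewrite -mulrDl subrK.
Unshelve. all: by end_near. Qed.

End counting.

(** * Typical words and entropy *)

Section itineraries.
Context {d} {T : measurableType d} {R : realType}.
Variables (mu : probability T R) (f : T -> T).
Hypotheses (mf : measurable_fun [set: T] f) (finv : invariant_measure mu f).

Definition word (I : finType) (p : T -> I) n x : {ffun 'I_n -> I} :=
  [ffun j : 'I_n => p (iter j f x)].

Lemma eq_word (I : finType) (p : T -> I) n x y j : (j < n)%N ->
  word p n x = word p n y -> p (iter j f x) = p (iter j f y).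
Proof. by move=> jn /ffunP/(_ (Ordinal jn)); rewrite !ffunE. Qed.

Lemma measurable_word (I : finType) (p : T -> I) n :
  measurable_labelling p -> measurable_labelling (word p n).
Proof.
move=> mp w; rewrite (_ : _ @^-1` _ =
    \bigcap_(j in [set: 'I_n]) (iter j f @^-1` (p @^-1` [set w j]))).
  apply: fin_bigcap_measurable => // j _; exact: measurable_preimage_iter.
apply/seteqP; split=> [x /= <- j _ /=|x px]; first by rewrite ffunE.
by apply/ffunP => j; rewrite ffunE; exact: px.
Qed.

Arguments measurable_word {I p} n.

(** The rates [c] play the role of upper bounds for the entropy of [p]; the sets
    [G n] are those of the typical words of length [n]. *)
Definition codable (I : finType) (p : T -> I) (c : R) :=
  exists G : forall n, {set {ffun 'I_n -> I}},
    (\forall n \near \oo, #|G n|%:R <= expR (c * n%:R)) /\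
    {ae mu, forall x, \forall n \near \oo, word p n x \in G n}.

Lemma codable_of_good (I : finType) (p : T -> I) (c : R)
    (good : nat -> T -> Prop) :
  {ae mu, forall x, \forall n \near \oo, good n x} ->
  (\forall n \near \oo,
     #|[set v | `[< exists2 x, good n x & word p n x = v >]]%SET|%:R <=
     expR (c * n%:R)) ->
  codable p c.
Proof.
move=> aegood card_good.
exists (fun n => [set v | `[< exists2 x, good n x & word p n x = v >]]%SET).
split=> //; apply: filterS aegood => x; apply: filterS => n gx.
by rewrite inE; apply/asboolP; exists x.
Qed.

Definition word_entropy (I : finType) (p : T -> I) n : R :=
  partition_entropy mu (fun w : {ffun 'I_n -> I} => word p n @^-1` [set w]).

Lemma word_entropy_ge0 (I : finType) (p : T -> I) n :
  measurable_labelling p -> 0 <= word_entropy p n.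
Proof.
move=> mp; rewrite oppr_ge0 sumr_le0// => w _; rewrite mulr_ge0_le0 ?fine_ge0//.
apply: ln_le0; rewrite -lee_fin probability_fineK; last exact: measurable_word.
by apply: probability_le1; exact: measurable_word.
Qed.

(** Few typical words force a small entropy: the atypical ones contribute at
    most their mass times the logarithm of the number of all words. *)
Lemma codable_word_entropy_le (I : finType) (p : T -> I) (c c' : R) :
  measurable_labelling p -> codable p c -> c < c' ->
  \forall n \near \oo, word_entropy p n <= c' * n%:R.
Proof.
move=> mp [G [cardG aeG]] cc'.
have mw n := measurable_word n mp.
pose K := `|ln (#|I|%:R : R) - c| + 1.
have K0 : 0 < K by rewrite ltr_wpDl.
pose e := (c' - c) / 2 / K.
have e0 : 0 < e by rewrite !divr_gt0// subr_gt0.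
have aeG' := ae_eventually_measureC e0
  (fun n => measurable_preimage_labelling [set` G n] (mw n)) aeG.
near=> n.
have n0 : (0 < n)%N by near: n; exists 1%N.
have := @entropy_le_card R _
  (fun w => fine (mu (word p n @^-1` [set w]))) (G n) (expR (c * n%:R)).
rewrite expRK card_ffun card_ord.
have I0 : (0 < #|I|)%N by apply/card_gt0P; exists (p point).
rewrite natrX lnXn ?ltr0n// -[ln _ *+ n]mulr_natr.
rewrite (_ : ln (#|I|%:R) * n%:R - c * n%:R = (ln (#|I|%:R) - c) * n%:R); last first.
  by rewrite mulrBl.
have -> : \sum_(w in ~: G n) fine (mu (word p n @^-1` [set w])) =
          fine (mu (~` (word p n @^-1` [set` G n]))).
  rewrite -(measure_labelling mu _ (mw n)); congr (fine (mu _)).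
  apply/seteqP; split=> x /=; rewrite !finset.in_setC; first by move/negP.
  by move=> ?; exact/negP.
set b := fine (mu (~` _)).
move=> /(_ (fun=> fine_ge0 (measure_ge0 _ _))).
move=> /(_ (sum_labelling mu (mw n)) (expR_gt0 _)).
have Gn : #|G n|%:R <= expR (c * n%:R) by near: n.
move=> /(_ Gn) h.
rewrite /word_entropy /partition_entropy; apply: (le_trans h).
have be : b <= e by rewrite /b; apply: ltW; near: n; exact: aeG'.
have b0 : 0 <= b by exact: fine_ge0.
have bK : b * (ln #|I|%:R - c) <= (c' - c) / 2.
  rewrite (@le_trans _ _ (e * K))//; last by rewrite /e divfK ?gt_eqF.
  rewrite (@le_trans _ _ (b * K))//; last by rewrite ler_wpM2r// ltW.
  by rewrite ler_wpM2l// (le_trans (ler_norm _))// lerDl.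
have n2 : 2 <= (c' - c) / 2 * n%:R.
  rewrite -ler_pdivrMl ?divr_gt0 ?subr_gt0//.
  near: n; exact: nbhs_infty_ger.
have := ler_wpM2r (ler0n R n) bK; rewrite -mulrA => bKn.
lra.
Unshelve. all: by end_near. Qed.

(** A block code: after an offset, a typical word of length [n] is a
    concatenation of words of length [N] whose probabilities multiply to at
    least [expR (- c * n)]; such concatenations are few since the products of
    the probabilities sum to one. *)
Lemma word_entropy_codable (I : finType) (p : T -> I) N (c : R) :
  ergodic mu f -> measurable_labelling p -> (0 < N)%N ->
  word_entropy p N < c * N%:R -> codable p c.
Proof.
move=> ferg mp N0 HN; have mw := measurable_word N mp.
have NR0 : 0 < (N%:R : R) by rewrite ltr0n.
have [c'' /andP[Hc'' c''c]] : exists c'', word_entropy p N / N%:R < c'' < c.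
  have HNc : word_entropy p N / N%:R < c by rewrite ltr_pdivrMr.
  by exists ((word_entropy p N / N%:R + c) / 2); rewrite !midf_lt.
pose m (b : {ffun 'I_N -> I}) := fine (mu (word p N @^-1` [set b])).
have m0 b : 0 <= m b by exact: fine_ge0.
have m1 : \sum_b m b = 1 by exact: sum_labelling.
have m_le1 b : m b <= 1 by rewrite -m1 (bigD1 b)//= lerDl sumr_ge0.
pose g x := - ln (m (word p N x)).
have g0 x : 0 <= g x by rewrite oppr_ge0 ln_le0.
have ig : \int[mu]_x g x < c'' * N%:R.
  rewrite (Rintegral_labelling mu (fun b => - ln (m b)) mw).
  by under eq_bigr do rewrite mulrN; rewrite sumrN -ltr_pdivrMr.
have aeg := birkhoff_eventually mf finv ferg
  (measurable_fun_labelling (fun b => - ln (m b)) mw)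
  (fun x => normr_finite_le (fun b => - ln (m b)) (word p N x)) ig.
have aem : {ae mu, forall x, forall j, 0 < m (word p N (iter j f x))}.
  apply: (ae_iter mf finv (P := fun x => 0 < m (word p N x))).
  have : mu (word p N @^-1` [set b | m b <= 0]) = 0%E.
    have mS := measurable_preimage_labelling [set` [set b | m b <= 0]%SET] mw.
    have -> : word p N @^-1` [set b | m b <= 0] =
       word p N @^-1` [set` [set b | m b <= 0]%SET].
      by apply/seteqP; split=> x /=; rewrite inE.
    rewrite -probability_fineK//; congr (_%:E).
    rewrite (measure_labelling mu _ mw) big1// => b; rewrite inE => mb.
    by apply/eqP; rewrite eq_le mb m0.
  move=> /(ae_measure0 (measurable_preimage_labelling _ mw)).
  by apply: filterS => x /=; rewrite ltNge => /negP.
pose good n x := (\sum_(j < n) g (iter j f x) <= c'' * N%:R * n%:R) /\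
  (forall j, 0 < m (word p N (iter j f x))).
(* the offset, the first [N] letters and the last [2 * N] letters *)
pose E : finType := ('I_N * {ffun 'I_N -> I} * {ffun 'I_(N + N) -> I})%type.
apply: (codable_of_good (good := good)).
  by apply: filterS2 aeg aem => x gx mx; apply: filterS gx => n gx; split.
have aeC := @near_expR_absorbs_constant R #|E|%:R _ _ c''c.
near=> n.
pose k := (n %/ N).-1.
pose blocks := [set b : {ffun 'I_k -> {ffun 'I_N -> I}} |
  expR (- (c'' * n%:R)) <= \prod_i m (b i)]%SET.
have nN : (N + N <= n)%N by near: n; exists (N + N)%N.
pose valid x (e : {ffun 'I_k -> {ffun 'I_N -> I}} * E) :=
  [/\ e.1 = [ffun i : 'I_k => word p N (iter (e.2.1.1 + i * N) f x)],
      e.2.1.2 = word p N x & e.2.2 = word p (N + N) (iter (n - (N + N)) f x)].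
have : (#|[set v | `[< exists2 x, good n x & word p n x = v >]]%SET| <=
        #|finset.setX blocks [set: E]%SET|)%N.
  apply: (card_words_le_codes (valid := valid)).
    move=> x [gx mx].
    have [r hr] : exists r : 'I_N,
        \sum_(i < k) g (iter (r + i * N) f x) <= c'' * n%:R.
      apply: (progression_le (a := fun j => g (iter j f x))) => //.
      by rewrite mulrCA mulrA.
    exists ([ffun i : 'I_k => word p N (iter (r + i * N) f x)],
            (r, word p N x, word p (N + N) (iter (n - (N + N)) f x))) => //.
    rewrite !inE/= andbT; under eq_bigr do rewrite ffunE.
    rewrite (eq_bigr (fun i : 'I_k => expR (- g (iter (r + i * N) f x)))).
      by rewrite -expR_sum ler_expR sumrN lerN2.
    by move=> i _; rewrite /g opprK lnK// posrE.
  move=> x y [b [[r pre] suf]] [/= bx prex sufx] [/= by_ prey sufy].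
  apply/ffunP => t; rewrite !ffunE.
  have [tr|rt] := ltnP t r.
    by apply: (@eq_word _ p N) => //; [exact: ltn_trans tr _|rewrite -prex].
  have [tn|nt] := ltnP t (n - (N + N)); last first.
    have tE : t = (t - (n - (N + N)) + (n - (N + N)))%N :> nat by rewrite subnK.
    rewrite tE !iterD; apply: (@eq_word _ p (N + N)); last by rewrite -sufx.
    by have := ltn_ord t; lia.
  have [_ nk] := block_bounds (ltn_ord r) (leq_trans (leq_addr N N) nN).
  have ik : ((t - r) %/ N < k)%N by rewrite ltn_divLR// ltn_subLR//; lia.
  rewrite (block_position N0 rt) !iterD.
  apply: (@eq_word _ p N); first by rewrite ltn_mod.
  move: bx; rewrite by_ => /ffunP/(_ (Ordinal ik)); rewrite !ffunE /=.
  by rewrite !iterD.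
rewrite -(ler_nat R) => /le_trans; apply.
rewrite cardsX cardsT natrM mulrC.
have : (#|E|%:R * expR (c'' * n%:R) <= expR (c * n%:R)) by near: n.
apply: le_trans; rewrite ler_wpM2l//.
have := card_heavy_words k m0 m1 (expR_gt0 (- (c'' * n%:R))).
by rewrite -expRN opprK.
Unshelve. all: by end_near. Qed.

End itineraries.

(** * The entropy of a partition as a growth rate *)

Section entropy_rate.
Context {d} {T : measurableType d} {R : realType}.
Variables (mu : probability T R) (f : T -> T).
Hypotheses (mf : measurable_fun [set: T] f) (finv : invariant_measure mu f).
Hypothesis ferg : ergodic mu f.

(** By block coding, every normalized block entropy bounds the growth rate of
    typical words, and this rate bounds all later normalized block entropies.
    So they converge to their infimum. *)
Lemma word_entropy_rate (I : finType) (p : T -> I) : measurable_labelling p ->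
  exists h : R, [/\
    (fun n => (n%:R^-1 * word_entropy mu f p n)%:E) @ \oo --> h%:E,
    forall c, h < c -> codable mu f p c & forall c, codable mu f p c -> h <= c].
Proof.
move=> mp; pose rates := [set word_entropy mu f p N.+1 / N.+1%:R | N in [set: nat]].
have rates_inf : has_inf rates.
  split; first by exists (word_entropy mu f p 1 / 1%:R); exists 0%N.
  by exists 0 => _ [N _ <-]; rewrite divr_ge0// word_entropy_ge0.
have inf_codable (c : R) : inf rates < c -> codable mu f p c.
  move=> /(inf_lt rates_inf.1)[_ [N _ <-]]; rewrite ltr_pdivrMr//.
  exact: word_entropy_codable.
have inf_le n : (0 < n)%N -> inf rates <= word_entropy mu f p n / n%:R.
  by case: n => // n _; apply: (ge_inf rates_inf.2); exists n.
exists (inf rates); split => //; last first.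
  move=> c cc; apply/ler_addgt0Pr => e e0.
  have ce : c < c + e by rewrite ltrDl.
  have := codable_word_entropy_le mf mp cc ce; case=> N _ /(_ N.+1 (leqnSn N)) /=.
  by rewrite -ler_pdivrMr//; apply: le_trans; exact: inf_le.
apply: cvg_EFin; first by apply: nearW.
apply/cvgrPdist_le => e e0.
have e2 : 0 < e / 2 by rewrite divr_gt0.
have hle : inf rates + e / 2 < inf rates + e.
  by rewrite ltrD2l ltr_pdivrMr// ltr_pMr// ltr1n.
have hlt : inf rates < inf rates + e / 2 by rewrite ltrDl.
have near_le := codable_word_entropy_le mf mp (inf_codable _ hlt) hle.
near=> n; have n0 : (0 < n)%N by near: n; exists 1%N.
rewrite /= mulrC ler_distlC; apply/andP; split.
  by rewrite lerBlDr (le_trans (inf_le _ n0))// lerDl ltW.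
by rewrite ler_pdivrMr ?ltr0n//; near: n.
Unshelve. all: by end_near. Qed.

Lemma partition_labelling k (P : 'I_k -> set T) :
  partition [set: 'I_k] P [set: T] -> (forall i, measurable (P i)) ->
  exists p : T -> 'I_k, [/\ measurable_labelling p,
    forall i, p @^-1` [set i] = P i &
    exists h : R, [/\ entropy_wrt mu f P = h%:E,
      forall c, h < c -> codable mu f p c &
      forall c, codable mu f p c -> h <= c]].
Proof.
move=> [Pcover Ptriv _] mP.
have inP x : exists i, P i x.
  by have [i _ Pix] : cover [set: 'I_k] P x; [rewrite Pcover|exists i].
pose p x := sval (cid (inP x)).
have pP x : P (p x) x by rewrite /p; case: cid.
have pE i : p @^-1` [set i] = P i.
  apply/seteqP; split=> [x /= <-//|x Pix /=].
  by apply: (Ptriv _ _ I I); exists x; split.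
have mp : measurable_labelling p by move=> i; rewrite pE.
exists p; split=> //; have [h [hcvg h1 h2]] := word_entropy_rate mp.
exists h; split=> //; rewrite /entropy_wrt; apply/cvg_lim => //.
rewrite (_ : (fun n => _) = (fun n => (n%:R^-1 * word_entropy mu f p n)%:E))//.
apply/funext => n; congr ((_ * partition_entropy _ _)%:E).
apply/funext => w; apply/seteqP; split=> [x Px|x <- j _ /=].
  apply/ffunP => j; rewrite ffunE.
  by have := Px j I; rewrite -pE.
by rewrite ffunE.
Qed.

(** The labels that do not occur are dropped, as the members of a partition are
    nonempty. *)
Lemma labelling_partition (I : finType) (p : T -> I) : measurable_labelling p ->
  exists k (P : 'I_k -> set T), [/\ partition [set: 'I_k] P [set: T],
    forall i, measurable (P i) & forall i x y, P i x -> P i y -> p x = p y].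
Proof.
move=> mp; pose J := [set i : I | `[< exists x, p x = i >]]%SET.
have pJ x : p x \in J by rewrite inE; apply/asboolP; exists x.
exists #|J|, (fun i => p @^-1` [set enum_val i]).
split=> [|i|i x y /= -> ->//]; last exact: mp.
split=> [|i j _ _ [x [/= pi pj]]|i _].
- apply/seteqP; split=> // x _; exists (enum_rank_in (pJ x) (p x)) => //=.
  by rewrite enum_rankK_in.
- by apply: enum_val_inj; rewrite -pi -pj.
- have := enum_valP i; rewrite inE => /asboolP[x xi]; exists x; exact: xi.
Qed.

End entropy_rate.

(** * Coding an orbit by its returns *)

Section block_sums.
Context {R : realType}.

Lemma sum_blocks (F : nat -> R) k b : (0 < b)%N ->
  \sum_(j < k * b) F (j %/ b)%N = b%:R * \sum_(i < k) F i.
Proof.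
move=> b0; elim: k => [|k IHk]; first by rewrite !big_ord0 mulr0.
rewrite mulSnr big_split_ord/= IHk big_ord_recr/= mulrDr; congr (_ + _).
rewrite (eq_bigr (fun=> F k)); first by rewrite sumr_const card_ord mulr_natl.
by move=> j _; rewrite divnMDl// divn_small// addn0.
Qed.

Lemma sum_ord_split (F : nat -> R) m n : (m <= n)%N ->
  \sum_(j < n) F j = \sum_(j < m) F j + \sum_(j < n - m) F (m + j)%N.
Proof. by move=> /subnKC mn; rewrite -[in LHS]mn big_split_ord. Qed.

Lemma sum_ord_le_card (F : nat -> R) n : (forall j, F j <= 1) ->
  \sum_(j < n) F j <= n%:R.
Proof.
move=> F1; apply: (@le_trans _ _ (\sum_(j < n) 1)); first exact: ler_sum.
by rewrite sumr_const card_ord.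
Qed.

End block_sums.

Section recurrence_coding.
Context {d} {T : measurableType d} {R : realType}.
Variables (mu : probability T R) (f : T -> T).
Hypotheses (mf : measurable_fun [set: T] f) (finv : invariant_measure mu f).
Hypothesis ferg : ergodic mu f.

Lemma visits_eventually (A : set T) (c : R) : measurable A -> fine (mu A) < c ->
  {ae mu, forall x, \forall n \near \oo,
    \sum_(j < n) \1_A (iter j f x) <= c * n%:R}.
Proof.
move=> mA Ac; apply: (birkhoff_eventually mf finv ferg (M := 1)).
- exact: measurable_indic.
- by move=> x; rewrite indicE; case: (_ \in _); rewrite ?normr1 ?normr0.
- by rewrite /Rintegral integral_indic// setIT.
Qed.

Variables (I J : finType) (p : T -> I) (q : T -> J) (W D : set T).
Variables (b L : nat) (eta theta : R).
Hypotheses (b0 : (0 < b)%N) (theta0 : 0 < theta) (theta1 : theta < 1).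
Hypotheses (mW : measurable W) (mD : measurable D).
Hypotheses (W_small : fine (mu W) < eta) (D_small : fine (mu D) < eta).
Hypothesis q_returns : forall x, ~ D x -> exists2 k, (k <= L)%N &
  forall j, (j < b)%N -> ~ W (iter j f x) ->
    q (iter j f x) = q (iter (j + k.+1) f x).
Hypothesis q_determines : forall x y, ~ W x -> ~ W y -> q x = q y -> p x = p y.

Let literal_weight := theta / (#|{: I * J}|%:R).
Let letter_weight (v : option (I * J)) :=
  if v is Some _ then literal_weight else 1 - theta.

(* The labels of the orbit are read from right to left: a label is either
   written down, or copied from the position reached after the return of the
   block that contains it. *)
Let valid n k (x : T)
    (c : {ffun 'I_n -> option (I * J)} * ('I_b * {ffun 'I_k -> 'I_L.+1})) :=
  forall t : 'I_n,
    c.1 t = Some (p (iter t f x), q (iter t f x)) \/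
    [/\ c.1 t = None, ~ W (iter t f x) & exists i : 'I_k,
        let s := (t + (c.2.2 i).+1)%N in
        [/\ i = (t - c.2.1) %/ b :> nat, (s < n)%N &
            q (iter t f x) = q (iter s f x)]]%N.

Let valid_inj n k x y c : @valid n k x c -> @valid n k y c ->
  word f p n x = word f p n y.
Proof.
move=> vx vy.
suff H m t : (n - t <= m)%N -> (t < n)%N ->
    p (iter t f x) = p (iter t f y) /\ q (iter t f x) = q (iter t f y).
  by apply/ffunP => t; rewrite !ffunE; have [] := H _ t (leqnn _) (ltn_ord t).
elim: m t => [|m IHm] t tm tn; first by move: tm tn; lia.
have [xt|[xt xW [i [/= it is_ xq]]]] := vx (Ordinal tn);
have [yt|[yt yW [i' [/= it' _ yq]]]] := vy (Ordinal tn).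
- by move: yt; rewrite xt => -[-> ->].
- by move: yt; rewrite xt.
- by move: yt; rewrite xt.
have ii' : i = i' by apply: val_inj => /=; rewrite it it'.
have qt : q (iter t f x) = q (iter t f y).
  have [||_ qs] := IHm (t + (c.2.2 i).+1)%N; [lia| by [] |].
  by rewrite xq qs yq ii'.
by split=> //; exact: q_determines.
Qed.

Let log_letters := ln (literal_weight^-1).

Let card_letters_gt0 : 0 < (#|{: I * J}|%:R : R).
Proof. by rewrite ltr0n; apply/card_gt0P; exists (p point, q point). Qed.

Let literal_weight_gt0 : 0 < literal_weight.
Proof. by rewrite divr_gt0. Qed.

Let log_letters_ge0 : 0 <= log_letters.
Proof.
apply: ln_ge0; rewrite invf_ge1// /literal_weight ler_pdivrMr// mul1r.
rewrite (le_trans (ltW theta1))// ler1n; move: card_letters_gt0.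
by rewrite ltr0n.
Qed.

Let sum_letter_weight : \sum_v letter_weight v = 1.
Proof.
rewrite (bigD1 None)//= (eq_bigr (fun=> literal_weight)); last by case.
rewrite sumr_const (_ : #|_| = #|{: I * J}|).
  by rewrite -[literal_weight *+ _]mulr_natr /literal_weight divfK ?gt_eqF// subrK.
have := cardC1 (None : option (I * J)); rewrite card_option /= => <-.
by apply: eq_card => v; rewrite !inE.
Qed.

Let many_literals n (c : {ffun 'I_n -> option (I * J)}) s :
  \sum_(t < n) (c t != None)%:R <= s ->
  expR (ln (1 - theta) * n%:R - log_letters * s) <=
    \prod_t letter_weight (c t).
Proof.
move=> cs; have omt : 0 < 1 - theta by rewrite subr_gt0.
rewrite (eq_bigr (fun t => expR (ln (letter_weight (c t))))); last first.
  by move=> t _; rewrite lnK// posrE /letter_weight; case: (c t).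
rewrite -expR_sum ler_expR.
apply: (@le_trans _ _ (\sum_(t < n)
    (ln (1 - theta) - log_letters * (c t != None)%:R))).
  rewrite sumrB sumr_const card_ord -[ln _ *+ n]mulr_natr lerD2l lerN2.
  by rewrite -mulr_sumr ler_wpM2l.
apply: ler_sum => t _; rewrite /letter_weight; case: (c t) => [v|] /=.
  rewrite mulr1 /log_letters lnV ?posrE// opprK gerDr ln_le0// gerBl.
  exact: ltW.
by rewrite mulr0 subr0.
Qed.

Let good n x :=
  \sum_(j < n) \1_W (iter j f x) <= eta * n%:R /\
  \sum_(j < n) \1_D (iter j f x) <= eta * n%:R.

Let code_good n x : let k := (n %/ b).-1 in (b + b + L < n)%N -> good n x ->
  exists2 c : {ffun 'I_n -> option (I * J)} * ('I_b * {ffun 'I_k -> 'I_L.+1}),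
    \sum_(t < n) (c.1 t != None)%:R <=
      2 * eta * n%:R + (b + b + b + L + 1)%:R & valid x c.
Proof.
move=> k nbL [xW xD].
have bR0 : 0 < (b%:R : R) by rewrite ltr0n.
have [r hr] : exists r : 'I_b,
    \sum_(i < k) (\1_D (iter (r + i * b) f x) : R) <= eta * n%:R / b%:R.
  apply: (progression_le (a := fun j => \1_D (iter j f x))) => //.
  by rewrite mulrC divfK ?gt_eqF.
have bn : (b <= n)%N by rewrite (leq_trans _ (ltnW nbL))// -addnA leq_addr.
have [kn nk] := block_bounds (ltn_ord r) bn.
have ret z : exists k : 'I_L.+1, ~ D z -> forall j, (j < b)%N ->
    ~ W (iter j f z) -> q (iter j f z) = q (iter (j + k.+1) f z).
  have [Dz|/q_returns[l lL hl]] := pselect (D z); first by exists ord0.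
  by exists (Ordinal (lL : (l < L.+1)%N)) => _.
pose kappa z := sval (cid (ret z)).
have kappaP z : ~ D z -> forall j, (j < b)%N -> ~ W (iter j f z) ->
    q (iter j f z) = q (iter (j + (kappa z).+1) f z).
  by rewrite /kappa; case: cid.
(* A copy is possible inside a good block, off [W], and if its source still lies
   in the coded segment. *)
pose start i := iter (r + i * b) f x.
pose lit t := [|| (iter t f x) \in W, (n <= t + L.+1)%N, (t < r)%N,
  (r + k * b <= t)%N | start ((t - r) %/ b)%N \in D].
exists ([ffun t : 'I_n => if lit t then Some (p (iter t f x), q (iter t f x))
                          else None],
        (r, [ffun i : 'I_k => kappa (start i)])); last first.
  move=> t /=; rewrite ffunE; case: ifPn => [_|]; first by left.
  move=> /norP[tW /norP[]]; rewrite -ltnNge => tL /norP[].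
  rewrite -leqNgt => rt /norP[]; rewrite -ltnNge => tk tD; right; split=> //.
    by move/mem_set; apply/negP.
  have ik : ((t - r) %/ b < k)%N by rewrite ltn_divLR// ltn_subLR.
  exists (Ordinal ik); rewrite ffunE /=.
  have sD : ~ D (start ((t - r) %/ b)%N) by move/mem_set; apply/negP.
  have tE := block_position b0 rt.
  split=> //; first by rewrite (leq_ltn_trans _ tL)// leq_add2l ltn_ord.
  have := kappaP _ sD ((t - r) %% b)%N; rewrite ltn_mod => /(_ b0).
  rewrite /start -!iterD -tE => -> //; last by move/mem_set; apply/negP.
  by rewrite addnAC -tE.
(* Summing over the positions by blocks, a bad block counts [b] times. *)
pose outer t : R := if (t < r)%N || (r + k * b <= t)%N then 1 else
  \1_D (start ((t - r) %/ b)%N).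
pose tail t : R := (n <= t + L.+1)%N%:R.
have outer01 t : 0 <= outer t <= 1.
  rewrite /outer; case: ifP => _; first by rewrite ler01 lexx.
  by rewrite indicE; case: (_ \in _); rewrite ?lexx ?ler01.
apply: (@le_trans _ _ (\sum_(t < n) (\1_W (iter t f x) + tail t + outer t))).
  apply: ler_sum => t _; rewrite ffunE /=.
  have -> : ((if lit t then Some (p (iter t f x), q (iter t f x)) else None)
      != None) = lit t by case: ifP.
  rewrite /lit /outer /tail !indicE.
  case: (_ \in W) => /=.
    by rewrite -addrA lerDl addr_ge0//; case/andP: (outer01 t).
  case: (n <= _)%N => /=; first by rewrite add0r lerDl; case/andP: (outer01 t).
  by rewrite !add0r orbA; case: ((t < r)%N || (r + k * b <= t)%N) => /=.
rewrite !big_split/= mulr2n !mulrDl mul1r -!addrA lerD//.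
have tail_le : \sum_(t < n) tail t <= L.+1%:R.
  have nL : (L.+1 <= n)%N by rewrite (leq_ltn_trans _ nbL)// leq_addl.
  rewrite (sum_ord_split tail (leq_subr L.+1 n)) subKn// big1 ?add0r.
    apply: (sum_ord_le_card (F := fun j => tail (n - L.+1 + j)%N)) => j.
    by rewrite /tail lern1 leq_b1.
  by move=> t _; rewrite /tail leqNgt addnC -ltn_subRL ltn_ord.
have outer_le : \sum_(t < n) outer t <= (b + b + b)%:R + eta * n%:R.
  rewrite (sum_ord_split outer kn) (sum_ord_split outer (leq_addr _ r)) addKn.
  have -> : \sum_(j < k * b) outer (r + j)%N =
            \sum_(j < k * b) \1_D (start (j %/ b)%N).
    apply: eq_bigr => j _; rewrite /outer addKn ifF//.
    by rewrite ltnNge leq_addr/= leq_add2l leqNgt ltn_ord.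
  rewrite (sum_blocks (fun i => \1_D (start i))) //.
  have h1 : \sum_(t < r) outer t <= b%:R.
    apply: le_trans (_ : r%:R <= _); last by rewrite ler_nat ltnW.
    by apply: sum_ord_le_card => t; case/andP: (outer01 t).
  have h2 : \sum_(t < n - (r + k * b)) outer (r + k * b + t)%N <= (b + b)%:R.
    apply: le_trans (_ : (n - (r + k * b))%:R <= _); last first.
      by rewrite ler_nat leq_subLR.
    apply: (sum_ord_le_card (F := fun t => outer _)) => t.
    by case/andP: (outer01 (r + k * b + t)%N).
  have h3 : b%:R * \sum_(i < k) \1_D (start i) <= eta * n%:R.
    by rewrite mulrC -ler_pdivlMr.
  rewrite !natrD in h2 *; lra.
rewrite -[L.+1]addn1 in tail_le; rewrite !natrD in tail_le outer_le *; lra.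
Qed.

(** A coding of the labels by recurrence. Cut the orbit into blocks of length
    [b]. Most of them start outside [D], so that copying the labels from the
    position reached after the return costs only the choice of a return time,
    that is [ln L.+1] per block; the labels in [W] and in the bad blocks are
    written down. *)
Lemma codable_of_returns c :
  ln L.+1%:R / b%:R - ln (1 - theta) +
    2 * eta * ln (#|{: I * J}|%:R / theta) < c ->
  codable mu f p c.
Proof.
rewrite -[_ / theta]invf_div -/literal_weight -/log_letters => hc.
apply: (codable_of_good (good := good)).
  apply: filterS2 (visits_eventually mW W_small) (visits_eventually mD D_small).
  by move=> x; apply: filterS2 => n hW hD; split.
have near_c := near_expR_absorbs_constant
  (b%:R * expR (log_letters * (b + b + b + L + 1)%:R)) hc.
near=> n.
pose k := (n %/ b).-1.
have nbL : (b + b + L < n)%N by near: n; exists (b + b + L).+1.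
set s : R := 2 * eta * n%:R + (b + b + b + L + 1)%:R.
pose heavy := [set c : {ffun 'I_n -> option (I * J)} |
  expR (ln (1 - theta) * n%:R - log_letters * s) <=
    \prod_t letter_weight (c t)]%SET.
have : (#|[set v | `[< exists2 x, good n x & word f p n x = v >]]%SET| <=
        #|finset.setX heavy [set: 'I_b * {ffun 'I_k -> 'I_L.+1}]%SET|)%N.
  apply: (card_words_le_codes (valid := @valid n k)); last first.
    by move=> x y c0; exact: valid_inj.
  move=> x /(code_good nbL)[c0 c0s c0x]; exists c0 => //.
  by rewrite !inE andbT; exact: many_literals.
rewrite -(ler_nat R) => /le_trans; apply.
rewrite cardsX cardsT natrM card_prod card_ffun !card_ord natrM natrX.
have letter0 v : 0 <= letter_weight v.
  by case: v => [v|] /=; rewrite ltW// subr_gt0.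
have := card_heavy_words n letter0 sum_letter_weight
  (expR_gt0 (ln (1 - theta) * n%:R - log_letters * s)).
rewrite -expRN => heavy_le.
have Lk : L.+1%:R ^+ k <= expR (ln L.+1%:R / b%:R * n%:R) :> R.
  rewrite -[X in X ^+ k]lnK ?posrE// -expRM_natr ler_expR.
  rewrite -mulrA ler_wpM2l ?ln_ge0 ?ler1n//.
  rewrite mulrC ler_pdivlMr ?ltr0n// -natrM ler_nat.
  by rewrite (leq_trans _ (leq_divM n b))// leq_mul2r leq_pred orbT.
have rate_le : b%:R * expR (log_letters * (b + b + b + L + 1)%:R) *
    expR ((ln L.+1%:R / b%:R - ln (1 - theta) + 2 * eta * log_letters) * n%:R)
    <= expR (c * n%:R) by near: n.
apply: le_trans rate_le; rewrite -mulrA -expRD.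
apply: le_trans (ler_pM _ _ heavy_le (ler_wpM2l _ Lk)) _ => //.
rewrite mulrCA -expRD ler_wpM2l// ler_expR le_eqVlt; apply/orP; left; apply/eqP.
rewrite /s; ring.
Unshelve. all: by end_near. Qed.

End recurrence_coding.

(** * Labellings that are locally constant off a small set *)

Section stable_approximation.
Context {R : realType} {X : pointedMetricType R}.
Variable mu : probability (borel X) R.

(** A substitute for the approximation of [A] by sets whose boundary is null:
    off the small set [W], membership in [B] does not change at the uniform
    scale [e]. *)
Definition stably_approximable (A : set X) := forall eta, 0 < eta ->
  exists (B W : set X) (e : R),
  [/\ measurable (W : set (borel X)), fine (mu W) < eta, 0 < e &
    forall z, ~ W z -> (A z <-> B z) /\
      forall z', mdist z z' < e -> (B z <-> B z')].

Lemma fine_measureU_lt (V W : set (borel X)) v w : measurable V -> measurable W ->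
  fine (mu V) < v -> fine (mu W) < w -> fine (mu (V `|` W)) < v + w.
Proof.
move=> mV mW Vv Ww; have mVW : measurable (V `|` W) by exact: measurableU.
rewrite -lte_fin probability_fineK//; apply: le_lt_trans (measureU2 mu mV mW) _.
rewrite -[X in (X + _)%E]probability_fineK//.
by rewrite -[X in (_ + X)%E]probability_fineK// -EFinD lte_fin ltrD.
Qed.

Lemma stably_approximableC A :
  stably_approximable A -> stably_approximable (~` A).
Proof.
move=> appA eta /appA[B [W [e [mW Weta e0 BW]]]].
exists (~` B), W, e; split=> // z /BW[AB Bz]; split.
  by split=> nA /AB.
by move=> z' /Bz zz'; split=> nB /zz'.
Qed.

Lemma stably_approximableU A A' : stably_approximable A ->
  stably_approximable A' -> stably_approximable (A `|` A').
Proof.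
move=> appA appA' eta eta0; have eta2 : 0 < eta / 2 by rewrite divr_gt0.
have [B [W [e [mW Weta e0 BW]]]] := appA _ eta2.
have [B' [W' [e' [mW' W'eta e'0 BW']]]] := appA' _ eta2.
exists (B `|` B'), (W `|` W'), (Num.min e e'); split.
- exact: measurableU.
- by rewrite [eta]splitr; exact: fine_measureU_lt.
- by rewrite lt_min e0.
move=> z /not_orP[/BW[AB Bz] /BW'[AB' B'z]]; split.
  by split=> -[]; by [move/AB; left|move/AB'; right].
move=> z'; rewrite lt_min => /andP[/Bz zz' /B'z zz''].
by split=> -[]; by [move/zz'; left|move/zz''; right].
Qed.

Lemma stably_approximable0 : stably_approximable set0.
Proof.
by move=> eta eta0; exists set0, set0, 1; split; rewrite ?measure0.
Qed.

(** A countable union is approximated by a finite one. *)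
Lemma stably_approximable_bigcup (F : nat -> set X) :
  (forall n, measurable (F n : set (borel X))) ->
  (forall n, stably_approximable (F n)) -> stably_approximable (\bigcup_n F n).
Proof.
move=> mF appF; pose G n := \big[setU/set0]_(i < n) F i.
have mG n : measurable (G n : set (borel X)).
  by apply: bigsetU_measurable => i _; exact: mF.
have appG n : stably_approximable (G n).
  apply: big_ind => //; first exact: stably_approximable0.
  exact: stably_approximableU.
have mU : measurable (\bigcup_n F n : set (borel X)) by exact: bigcupT_measurable.
move=> eta eta0; have eta2 : 0 < eta / 2 by rewrite divr_gt0.
have [n Gn] : exists n, fine (mu (\bigcup_n F n `\` G n)) < eta / 2.
  have mH n : measurable (~` (\bigcup_n F n `\` G n) : set (borel X)).
    by apply: measurableC; exact: measurableD.
  suff aeH : {ae mu, forall x, \forall n \near \oo, (~` (\bigcup_n F n `\` G n)) x}.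
    have [N _ HN] := ae_eventually_measureC eta2 mH aeH.
    by have := HN N (leqnn N); rewrite /= setCK; exists N.
  apply: aeW => x; have [[i _ Fix]|nF] := pselect ((\bigcup_n F n) x); last first.
      by apply: nearW => n [].
    exists i.+1 => // n /= ni [_]; apply; rewrite /G -bigcup_mkord.
    by exists i.
have [B [W [e [mW Weta e0 BW]]]] := appG n _ eta2.
exists B, (W `|` (\bigcup_n F n `\` G n)), e; split=> //.
- by apply: measurableU => //; exact: measurableD.
- by rewrite [eta]splitr; apply: fine_measureU_lt => //; exact: measurableD.
move=> z /not_orP[/BW[GB Bz] nUG]; split=> //; split=> [Uz|/GB].
  by apply/GB; apply: contrapT => nG; exact: nUG.
by rewrite /G -bigcup_mkord => -[i _ Fiz]; exists i.
Qed.

(** An open set is approximated by the set of its points that are far from the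
    complement. *)
Lemma stably_approximable_open (U : set X) : open U -> stably_approximable U.
Proof.
move=> oU eta eta0.
pose V (s : R) := [set z : X | exists2 t, s < t & ball z t `<=` U].
have oV s : open (V s).
  rewrite openE => z [t st ztU]; apply/nbhs_ballP.
  exists ((t - s) / 2) => /=; first by rewrite divr_gt0// subr_gt0.
  move=> y zy; exists ((s + t) / 2); first by rewrite !midf_lt.
  move=> x yx; apply: ztU; have -> : t = (t - s) / 2 + (s + t) / 2 by field.
  exact: ball_triangle zy yx.
have mO (O : set X) : open O -> measurable (O : set (borel X)).
  by move=> oO; exact: sub_sigma_algebra.
have [n Vn] : exists n, fine (mu (U `\` V n.+1%:R^-1)) < eta.
  have mH n : measurable (~` (U `\` V n.+1%:R^-1) : set (borel X)).
    by apply: measurableC; apply: measurableD; exact: mO.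
  suff aeH : {ae mu, forall x, \forall n \near \oo, (~` (U `\` V n.+1%:R^-1)) x}.
    have [N _ HN] := ae_eventually_measureC eta0 mH aeH.
    by have := HN N (leqnn N); rewrite /= setCK; exists N.
  apply: aeW => x; have [Ux|nU] := pselect (U x); last first.
      by apply: nearW => n [].
    move: (oU); rewrite openE => /(_ _ Ux)/nbhs_ballP[t /= t0 xtU].
    near=> n => -[_]; apply; exists t => //.
    by near: n; exact: near_infty_natSinv_lt (PosNum t0).
pose s : R := n.+1%:R^-1 / 2; have s0 : 0 < s by rewrite divr_gt0.
exists (V s), (U `\` V n.+1%:R^-1), s; split=> //.
  by apply: measurableD; exact: mO.
have Vs_of z z' : V n.+1%:R^-1 z -> mdist z z' < s -> V s z'.
  move=> [t st ztU] zz'; exists (t - s); first by rewrite ltrBrDr -splitr.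
  move=> y z'y; apply: ztU; rewrite -(subrK s t) addrC.
  by apply: ball_triangle z'y; rewrite ballEmdist.
have VU z : V s z -> U z.
  by move=> [t st]; apply; apply: ballxx; exact: lt_trans st.
move=> z nW; have [Uz|nUz] := pselect (U z).
  have Vz : V n.+1%:R^-1 z by apply: contrapT => nV; exact: nW.
  have Vsz : V s z by apply: (Vs_of _ _ Vz); rewrite mdistxx.
  by split=> [//|z' zz']; split=> // _; exact: Vs_of Vz zz'.
split; first by split=> // /VU.
move=> z' zz'; split=> [/VU //|[t st z'tU]]; case: nUz; apply: z'tU.
by rewrite ballEmdist /= metric_sym (lt_trans zz').
Unshelve. all: by end_near. Qed.

Lemma measurable_stably_approximable (A : set (borel X)) :
  measurable A -> stably_approximable A.
Proof.
suff H : <<s [set U : set X | open U] >> `<=`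
    [set A | measurable (A : set (borel X)) /\ stably_approximable A].
  by move=> mA; have [] := H A mA.
apply: smallest_sub; last first.
  by move=> U oU; split; [exact: sub_sigma_algebra|exact: stably_approximable_open].
split=> [|B [mB appB]|F mF].
- by split; [exact: measurable0|exact: stably_approximable0].
- by rewrite setTD; split; [exact: measurableC|exact: stably_approximableC].
- split; first by apply: bigcupT_measurable => n; have [] := mF n.
  by apply: stably_approximable_bigcup => n; have [] := mF n.
Qed.

(** Every label set is approximated separately; [q] records which of the
    approximating sets contain a point. Its values lie in a type that does not
    depend on [eta], so that their number can be fixed before [eta]. *)
Lemma labelling_stable_approximation (I : finType) (p : X -> I) eta :
  measurable_labelling (p : borel X -> I) -> 0 < eta ->
  exists (q : X -> {ffun I -> bool}) (W : set X) (e : R),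
  [/\ measurable (W : set (borel X)), fine (mu W) < eta, 0 < e,
    forall z z', ~ W z -> mdist z z' < e -> q z = q z' &
    forall z z', ~ W z -> ~ W z' -> q z = q z' -> p z = p z'].
Proof.
move=> mp eta0.
suff [B [W [e [mW Weta e0 BW]]]] : exists (B : I -> set X) (W : set X) (e : R),
    [/\ measurable (W : set (borel X)), fine (mu W) < eta, 0 < e &
    forall i z, i \in enum I -> ~ W z -> (p z = i <-> B i z) /\
      forall z', mdist z z' < e -> (B i z <-> B i z')].
  exists (fun z => [ffun i => `[< B i z >]]), W, e; split=> //.
    move=> z z' Wz zz'; apply/ffunP => i; rewrite !ffunE.
    have [_ /(_ _ zz') Bzz'] := BW i z (mem_enum _ i) Wz.
    exact: asbool_equiv_eq.
  move=> z z' Wz Wz' /ffunP/(_ (p z)); rewrite !ffunE => Bzz'.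
  have [/(_ erefl) Bz _] := (BW (p z) z (mem_enum _ _) Wz).1.
  apply/esym/(BW (p z) z' (mem_enum _ _) Wz').1.
  by apply/asboolP; rewrite -Bzz'; apply/asboolP.
elim: (enum I) eta eta0 => [|i s IHs] eta eta0.
  by exists (fun=> set0), set0, 1; split; rewrite ?measure0.
have eta2 : 0 < eta / 2 by rewrite divr_gt0.
have [B [W [e [mW Weta e0 BW]]]] := IHs _ eta2.
have [C [V [e' [mV Veta e'0 CV]]]] := measurable_stably_approximable (mp i) eta2.
exists (fun j => if j == i then C else B j), (W `|` V), (Num.min e e'); split.
- exact: measurableU.
- by rewrite [eta]splitr; exact: fine_measureU_lt.
- by rewrite lt_min e0.
move=> j z js /not_orP[Wz Vz]; case: eqP => [->|/eqP ji].
  have [pC Cz] := CV z Vz; split=> [//|z']; rewrite lt_min => /andP[_].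
  exact: Cz.
have {}js : j \in s by move: js; rewrite inE (negbTE ji).
have [pB Bz] := BW j z js Wz; split=> [//|z']; rewrite lt_min => /andP[+ _].
exact: Bz.
Qed.

End stable_approximation.

(** * Recurrence of typical words *)

Section return_statistics.
Context {d} {T : measurableType d} {R : realType}.
Variables (mu : probability T R) (f : T -> T).

(** The Borel-Cantelli lemma for measures dominated by a geometric series *)
Lemma ae_eventually_notin (F : nat -> set T) (z : R) : 0 < z -> z < 1 ->
  (forall n, measurable (F n)) -> (forall n, fine (mu (F n)) <= z ^+ n) ->
  {ae mu, forall x, \forall n \near \oo, ~ F n x}.
Proof.
move=> z0 z1 mF Fz.
have lim0 : mu (lim_sup_set F) = 0%E.
  apply: lim_sup_set_cvg0 => //.
  apply: (@le_lt_trans _ _ ((1 * (1 - z)^-1)%:E)); last exact: ltry.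
  apply: lime_le; first by apply: is_cvg_nneseries => *; exact: measure_ge0.
  apply: nearW => n; apply: (@le_trans _ _ ((series (geometric 1 z) n)%:E)).
    rewrite /series/= -sumEFin; apply: lee_sum => i _.
    by rewrite -probability_fineK// lee_fin mul1r.
  rewrite lee_fin; apply: geometric_le_lim => //.
  by rewrite ger0_norm ?ltW.
have mL : measurable (lim_sup_set F).
  by apply: bigcapT_measurable => n; exact: bigcup_measurable.
apply: filterS (ae_measure0 mL lim0) => x nL.
apply: contrapT => nF; apply: nL => N _; apply: contrapT => nFN.
by apply: nF; exists N => // n /= Nn Fnx; apply: nFN; exists n.
Qed.

Hypotheses (mf : measurable_fun [set: T] f) (finv : invariant_measure mu f).

(** The preimages of the set under [f^i], [i <= L], are pairwise disjoint and
    have the same measure. *)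
Lemma measure_no_return_le (A : set T) L : measurable A ->
  L.+1%:R * fine (mu (A `&`
    [set x | forall k, (k < L)%N -> ~ A (iter k.+1 f x)])) <= 1.
Proof.
move=> mA; set D := A `&` _.
have mD : measurable D.
  rewrite /D (_ : [set x | _] =
      \bigcap_(k in [set k | (k < L)%N]) ~` (iter k.+1 f @^-1` A)).
    apply: measurableI => //; apply: bigcap_measurableType => k _.
    by apply: measurableC; exact: measurable_preimage_iter.
  by apply/seteqP; split=> x xA k /=; exact: xA.
have noreturn i j x : (i < j <= L)%N -> D (iter i f x) -> ~ D (iter j f x).
  move=> /andP[ij jL] [_ /(_ (j - i).-1)].
  have jiE : (j - i).-1.+1 = (j - i)%N by lia.
  rewrite jiE -iterD subnK ?(ltnW ij)// => nA [Aj _]; apply: nA Aj; lia.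
have triv : trivIset [set: 'I_L.+1] (fun i : 'I_L.+1 => iter i f @^-1` D).
  move=> i j _ _ [x [/= Di Dj]]; apply/val_inj/eqP; rewrite eqn_leq.
  apply/andP; split; rewrite leqNgt; apply/negP => ij.
  - by apply: noreturn Dj Di; apply/andP; split=> //; rewrite -ltnS; exact: ltn_ord.
  - by apply: noreturn Di Dj; apply/andP; split=> //; rewrite -ltnS; exact: ltn_ord.
have mDi (i : 'I_L.+1) : measurable (iter i f @^-1` D).
  exact: measurable_preimage_iter.
have mU : measurable (\big[setU/set0]_(i < L.+1) (iter i f @^-1` D)).
  by apply: bigsetU_measurable => i _; exact: mDi.
have := probability_le1 mu mU; rewrite (measure_bigsetU_ord _ _ mDi triv).
rewrite (eq_bigr (fun=> (fine (mu D))%:E)); last first.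
  by move=> i _; rewrite probability_fineK//; exact: measure_preimage_iter.
by rewrite sumEFin lee_fin sumr_const card_ord mulr_natl.
Qed.

(** By [measure_no_return_le], the points whose word is typical and does not
    recur by time [expR (c' * n)] have measure at most [expR ((c - c') * n)],
    which is summable. *)
Lemma codable_word_returns (I : finType) (p : T -> I) (c c' : R) :
  measurable_labelling p -> codable mu f p c -> c < c' ->
  {ae mu, forall x, \forall n \near \oo, exists k,
    [/\ (0 < k)%N, k%:R <= expR (c' * n%:R) &
        word f p n (iter k f x) = word f p n x]}.
Proof.
move=> mp [G [cardG aeG]] cc'.
(* The bound on the number of words holds only for large [n]. *)
pose G' n := if #|G n|%:R <= expR (c * n%:R) then G n else finset.set0.
have cardG' n : #|G' n|%:R <= expR (c * n%:R).
  by rewrite /G'; case: ifP => // _; rewrite cards0 expR_ge0.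
pose L n := Num.truncn (expR (c' * n%:R)).
have mw n : measurable_labelling (word f p n) by exact: measurable_word.
pose D n w := (word f p n @^-1` [set w]) `&`
  [set x | forall k, (k < L n)%N -> ~ (word f p n @^-1` [set w]) (iter k.+1 f x)].
pose F n := \big[setU/set0]_(w in G' n) D n w.
have mD n w : measurable (D n w).
  rewrite /D (_ : [set x | _] = \bigcap_(k in [set k | (k < L n)%N])
      ~` (iter k.+1 f @^-1` (word f p n @^-1` [set w]))).
    apply: measurableI; first exact: mw.
    apply: bigcap_measurableType => k _.
    by apply: measurableC; apply: measurable_preimage_iter => //; exact: mw.
  by apply/seteqP; split=> x xA k /=; exact: xA.
have mF n : measurable (F n) by apply: bigsetU_measurable.
have DL n w : fine (mu (D n w)) <= expR (- (c' * n%:R)).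
  have := @measure_no_return_le _ (L n) (mw n w).
  rewrite -/(D n w) => h; rewrite expRN -[leRHS]mul1r ler_pdivlMr ?expR_gt0//.
  apply: le_trans h; rewrite mulrC ler_wpM2r ?fine_ge0// ltW//.
  exact: truncnS_gt.
have Fz n : fine (mu (F n)) <= expR (c - c') ^+ n.
  have Fle : fine (mu (F n)) <= \sum_(w in G' n) fine (mu (D n w)).
    rewrite -lee_fin probability_fineK// -sumEFin.
    suff [_ //] : measurable (F n) /\
        (mu (F n) <= \sum_(w in G' n) (fine (mu (D n w)))%:E)%E.
    rewrite /F; elim/big_rec2 : _ => [|w u U _ [mU Uu]]; first by rewrite measure0.
    split; first exact: measurableU.
    apply: le_trans (measureU2 mu _ _) _ => //.
    by rewrite probability_fineK// leeD2l.
  apply: le_trans Fle _.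
  apply: (@le_trans _ _ (\sum_(w in G' n) expR (- (c' * n%:R)))).
    exact: ler_sum.
  rewrite sumr_const -[_ *+ _]mulr_natl -expRM_natr mulrBl expRD.
  by rewrite ler_wpM2r ?expR_ge0.
have aeF := ae_eventually_notin (expR_gt0 _) _ mF Fz.
have {}aeF := aeF ltac:(by rewrite -expR0 ltr_expR subr_lt0).
apply: filterS2 aeG aeF => x Gx Fx; near=> n.
have wG : word f p n x \in G' n.
  have cG : #|G n|%:R <= expR (c * n%:R) by near: n.
  by rewrite /G' cG; near: n.
have nF : ~ F n x by near: n.
apply: contrapT => nk; apply: nF; rewrite /F (bigD1 (word f p n x))//=; left.
split=> // k kL wk; apply: nk; exists k.+1; split=> //.
by rewrite -truncn_gt_nat.
Unshelve. all: by end_near. Qed.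

End return_statistics.

(** * Return times to dynamical balls *)

Section return_times.
Context {R : realType} {X : metricType R}.
Variable f : X -> X.

Lemma return_time_leP n x e (r : R) : (return_time f n x e <= r%:E)%E <->
  exists k, [/\ (0 < k)%N, k%:R <= r & dynamical_ball f x n e (iter k f x)].
Proof.
split=> [Rr|[k [k0 kr xk]]]; last first.
  apply: le_trans (_ : (k%:R)%:E <= _)%E; last by rewrite lee_fin.
  by apply: ereal_inf_lbound; exists k.
have : (return_time f n x e < (Num.truncn r).+1%:R%:E)%E.
  by rewrite (le_lt_trans Rr)// lte_fin truncnS_gt.
move=> /ereal_inf_lt[_ [k [k0 xk] <-]]; rewrite lte_fin ltr_nat ltnS => kr.
exists k; split=> //.
by case: k k0 kr {xk} => // k _; rewrite truncn_gt_nat.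
Qed.

Lemma return_time_ge1 n x e : (1 <= return_time f n x e)%E.
Proof.
by apply: le_ereal_inf_tmp => _ [k [k1 _] <-]; rewrite lee_fin ler1n.
Qed.

Lemma return_time_le_scale n x e e' : e <= e' ->
  (return_time f n x e' <= return_time f n x e)%E.
Proof.
move=> ee'; apply: le_ereal_inf => _ [k [k1 xk] <-]; exists k => //; split=> //.
by move=> j jn; exact: lt_le_trans (xk j jn) ee'.
Qed.

Lemma return_time_step n x e :
  (return_time f n (f x) e <= return_time f n.+1 x e)%E.
Proof.
apply: le_ereal_inf => _ [k [k1 xk] <-]; exists k => //; split=> // j jn.
by rewrite -iterSr -(iterSr k) iterS -!iterSr; exact: (xk j.+1 jn).
Qed.

End return_times.

Section borel_dynamics.
Context {R : realType} {X : pointedMetricType R}.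
Variable f : X -> X.
Hypothesis f_continuous : continuous f.

Lemma measurable_open (U : set X) : open U -> measurable (U : set (borel X)).
Proof. by move=> oU; exact: sub_sigma_algebra. Qed.

Lemma measurable_fun_borel : measurable_fun [set: borel X] (f : borel X -> borel X).
Proof.
apply: (@measurability _ _ (borel X) (borel X) _ f (@open X) erefl) => _ [U oU <-].
by rewrite setTI; apply: measurable_open; move/continuousP: f_continuous; apply.
Qed.

Lemma continuous_iter n : continuous (iter n f).
Proof.
elim: n => [|n IHn] x; first exact: cvg_id.
by apply: (@continuous_comp _ _ _ (iter n f) f); [exact: IHn|exact: f_continuous].
Qed.

Lemma open_close_iterates i j (e : R) :
  open [set x | mdist (iter i f x) (iter j f x) < e].
Proof.
rewrite openE => x /= xe; set t := (e - mdist (iter i f x) (iter j f x)) / 2.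
have t0 : 0 < t by rewrite divr_gt0// subr_gt0.
have near_iter k : \forall y \near x, mdist (iter k f x) (iter k f y) < t.
  have kx : nbhs x (iter k f @^-1` ball (iter k f x) t).
    by apply: continuous_iter; exact: nbhsx_ballx.
  by apply: filterS kx => y; rewrite /preimage /= ballEmdist.
apply: filterS2 (near_iter i) (near_iter j) => y yi yj /=.
apply: le_lt_trans (metric_triangle _ (iter i f x) _) _.
apply: le_lt_trans (lerD (lexx _) (metric_triangle _ (iter j f x) _)) _.
rewrite metric_sym; move: yi yj; rewrite /t; lra.
Qed.

Lemma measurable_return n k e : measurable
  ([set x | dynamical_ball f x n e (iter k f x)] : set (borel X)).
Proof.
rewrite (_ : [set x | _] = \bigcap_(j in [set j | (j < n)%N])
  [set x | mdist (iter j f x) (iter (j + k) f x) < e]).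
  apply: bigcap_measurableType => j _; apply: measurable_open.
  exact: open_close_iterates.
by apply/seteqP; split=> x xk j jn; have := xk j jn; rewrite /= iterD.
Qed.

Lemma measurable_return_time_le n e r :
  measurable ([set x | (return_time f n x e <= r%:E)%E] : set (borel X)).
Proof.
rewrite (_ : [set x | _] = \bigcup_(k in [set k | (0 < k)%N /\ k%:R <= r])
  [set x | dynamical_ball f x n e (iter k f x)]).
  by apply: bigcup_measurable => k _; exact: measurable_return.
apply/seteqP; split=> [x /return_time_leP[k [k0 kr xk]]|x [k [k0 kr] xk]].
  by exists k.
by apply/return_time_leP; exists k.
Qed.

End borel_dynamics.

Section small_labelling.
Context {R : realType} {X : pointedMetricType R}.
Hypothesis X_compact : compact [set: X].

Lemma open_mdist (x : X) (e : R) : open [set y : X | mdist x y < e].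
Proof.
rewrite openE => y /= xy; apply/nbhs_ballP; exists (e - mdist x y) => /=.
  by rewrite subr_gt0.
move=> z; rewrite ballEmdist /= => yz.
by rewrite (le_lt_trans (metric_triangle _ y _))// -ltrBrDl.
Qed.

(** A point is labelled by the members of a finite cover by small balls that
    contain it. *)
Lemma small_labelling (e : R) : 0 < e -> exists (I : finType) (p : X -> I),
  measurable_labelling (p : borel X -> I) /\
  forall x y, p x = p y -> mdist x y < e.
Proof.
move=> e0; have e2 : 0 < e / 2 by rewrite divr_gt0.
have := X_compact; rewrite compact_cover.
move=> /(_ X [set: X] (fun x => [set y | mdist x y < e / 2])).
case=> [x _|x _|D _ Dcover]; [exact: open_mdist|by exists x => //=; rewrite mdistxx|].
exists {ffun D -> bool}, (fun x => [ffun z : D => mdist (val z) x < e / 2]).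
split=> [w|x y /ffunP xy].
  rewrite (_ : _ @^-1` _ = \bigcap_(z in [set: D])
      (if w z then [set x : X | mdist (val z) x < e / 2]
       else ~` [set x : X | mdist (val z) x < e / 2])).
    apply: fin_bigcap_measurable => // z _; case: (w z).
      by apply: measurable_open; exact: open_mdist.
    by apply: measurableC; apply: measurable_open; exact: open_mdist.
  apply/seteqP; split=> [x /= <- z _|x xw].
    by rewrite ffunE; case: ifP => //= ->.
  apply/ffunP => z; rewrite ffunE; have := xw z I.
  by case: (w z) => //=; move/negP/negbTE.
have [z /= Dz zx] := Dcover x I.
have := xy [` Dz]%fset; rewrite !ffunE /= zx => /esym zy.
rewrite (le_lt_trans (metric_triangle _ z _))// metric_sym.
by rewrite [e]splitr ltrD.
Qed.

End small_labelling.

(** * Exponential rates of return times *)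

Section return_time_rates.
Context {R : realType} {X : pointedMetricType R}.
Variables (f : X -> X) (mu : probability (borel X) R).
Hypotheses (X_compact : compact [set: X]) (f_continuous : continuous f).
Hypotheses (finv : invariant_measure mu f) (ferg : ergodic mu f).

Let mf := measurable_fun_borel f_continuous.

(** For a partition into sets of diameter less than [e], the recurrence of the
    word of length [n] implies the return to the dynamical ball. *)
Lemma return_time_upper c e : (metric_entropy mu f < c%:E)%E -> 0 < e ->
  {ae mu, forall x, \forall n \near \oo,
    (return_time f n x e <= (expR (c * n%:R))%:E)%E}.
Proof.
move=> hc e0; have [I [p0 [mp0 p0e]]] := small_labelling X_compact e0.
have [k [P [partP mP Pp0]]] := labelling_partition mp0.
have [p [mp pP [h [hE h_codable _]]]] := partition_labelling mf finv ferg partP mP.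
have h_lt : h < c.
  rewrite -lte_fin -hE; apply: le_lt_trans hc; apply: ereal_sup_ubound.
  by exists k, P.
have [c' /andP[hc' c'c]] : exists c', h < c' < c.
  by exists ((h + c) / 2); rewrite !midf_lt.
have pe x y : p x = p y -> mdist x y < e.
  move=> pxy; apply: p0e; apply: (Pp0 (p x)); first by rewrite -pP.
  by rewrite -pP /= pxy.
apply: filterS (codable_word_returns mf finv mp (h_codable _ hc') c'c) => x.
apply: filterS => n [j [j0 jn wj]]; apply/return_time_leP; exists j; split=> //.
by move=> i ik; apply/pe/esym; exact: eq_word wj.
Qed.

(** The set is mapped into itself since [R_n (f x) <= R_n.+1 (x)]; the factor [K]
    absorbs the shift of [n]. *)
Lemma return_time_exp_bound01 (c e : R) :
  let A := [set x | exists K : nat, forall n, (K <= n)%N ->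
    (return_time f n x e <= (K%:R * expR (c * n%:R))%:E)%E] in
  measurable (A : set (borel X)) /\ (mu A = 0%E \/ mu A = 1%E).
Proof.
move=> A; have mA : measurable (A : set (borel X)).
  rewrite (_ : A = \bigcup_K \bigcap_(n in [set n | (K <= n)%N])
      [set x | (return_time f n x e <= (K%:R * expR (c * n%:R))%:E)%E]).
    apply: bigcupT_measurable => K; apply: bigcap_measurableType => n _.
    exact: measurable_return_time_le.
  apply/seteqP; split=> [x [K xK]|x [K _ xK]]; first by exists K => //= n; exact: xK.
  by exists K => n Kn; exact: xK.
split=> //; apply: (ergodic_sub_preimage mf finv ferg mA) => x [K xK].
exists (maxn K (Num.truncn (K%:R * expR c)).+1) => n; rewrite geq_max => /andP[Kn _].
apply: le_trans (return_time_step f n x e) _.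
apply: le_trans (xK n.+1 (leqW Kn)) _; rewrite lee_fin -natr1 mulrDr mulr1 addrC.
rewrite expRD mulrA ler_wpM2r ?expR_ge0//; apply/ltW.
by apply: lt_le_trans (truncnS_gt _) _; rewrite ler_nat leq_maxr.
Qed.

(** Were the return times eventually at most [expR (c * n)] on a set of
    positive measure, they would be so, up to a factor, almost everywhere, and
    recurrence would code the labels of a partition at a rate below its
    entropy. *)
Lemma return_time_lower c : (c%:E < metric_entropy mu f)%E ->
  exists2 e, 0 < e & {ae mu, forall x, ~ \forall n \near \oo,
    (return_time f n x e <= (expR (c * n%:R))%:E)%E}.
Proof.
move=> /ereal_sup_gt[_ [k [P [partP mP ->]]]].
have [p [mp _ [h [-> _ codable_ge]]]] := partition_labelling mf finv ferg partP mP.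
rewrite lte_fin => ch; pose delta := (h - c) / 4.
have delta0 : 0 < delta by rewrite divr_gt0// subr_gt0.
(* so that [- ln (1 - theta) = delta] *)
pose theta := 1 - expR (- delta).
have theta1 : theta < 1 by rewrite gtrBl expR_gt0.
have theta0 : 0 < theta by rewrite subr_gt0 -expR0 ltr_expR oppr_lt0.
pose M : R := #|{: 'I_k * {ffun 'I_k -> bool}}|%:R.
pose K := `|ln (M / theta)| + 1; have K0 : 0 < K by rewrite ltr_wpDl.
(* [2 * eta * ln (M / theta) <= delta], and [eta <= 1] excludes that all points
   are bad *)
pose eta := Num.min 1 (delta / 2 / K).
have eta0 : 0 < eta by rewrite /eta lt_min ltr01/= divr_gt0// divr_gt0.
have eta1 : eta <= 1 by rewrite /eta ge_min lexx.
have etaK : 2 * eta * ln (M / theta) <= delta.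
  have : eta * ln (M / theta) <= delta / 2.
    apply: (@le_trans _ _ (eta * K)).
      by rewrite ler_wpM2l ?ltW// ltr_pwDr// ler_norm.
    by rewrite -ler_pdivlMr// /eta ge_min lexx orbT.
  lra.
have [q [W [e [mW Weta e0 q_stable q_det]]]] :=
  labelling_stable_approximation mu mp eta0.
exists e => //.
set A := [set x | exists K : nat, forall n, (K <= n)%N ->
    (return_time f n x e <= (K%:R * expR (c * n%:R))%:E)%E].
have [mA [A0|A1]] := return_time_exp_bound01 c e.
  apply: filterS (ae_measure0 mA A0) => x nA [N _ xN]; apply: nA.
  exists N.+1 => n Nn; apply: le_trans (xN n (ltnW Nn)) _.
  by rewrite lee_fin ler_peMl ?expR_ge0// ler1n.
exfalso.
pose c' := c + delta; have cc' : c < c' by rewrite ltrDl.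
pose E n : set (borel X) :=
  [set x | (return_time f n x e <= (expR (c' * n%:R))%:E)%E].
have mE n : measurable (E n : set (borel X)) by exact: measurable_return_time_le.
have aeE : {ae mu, forall x : borel X, \forall n \near \oo, E n x}.
  have ae_filter : Filter (nbhs (almost_everywhere mu)).
    exact: ae_filter_ringOfSetsType.
  apply: filterS (ae_measure1 mA A1) => x [N xN].
  have near_N : \forall n \near \oo, (N <= n)%N by exists N.
  apply: filterS2 near_N (near_expR_absorbs_constant N%:R cc') => n Nn rate_n.
  by apply: le_trans (xN n Nn) _; rewrite lee_fin.
have [b [b0 Eb]] : exists b, (0 < b)%N /\ fine (mu (~` E b)) < eta.
  have [N _ HN] := ae_eventually_measureC eta0 mE aeE.
  by exists N.+1; split=> //; exact: (HN N.+1 (leqnSn N)).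
(* Otherwise no return time would be small enough, and [E b] would be empty. *)
have trunc_gt0 : (0 < Num.truncn (expR (c' * b%:R)))%N.
  rewrite truncn_gt0 leNgt; apply/negP => lt1.
  have E0 : E b = set0.
    apply/seteqP; split=> // x /return_time_leP[j [j0 jE _]].
    by move: lt1; rewrite ltNge (le_trans _ jE)// ler1n.
  by move: Eb; rewrite E0 setC0 probability_setT /= ltNge eta1.
pose L := (Num.truncn (expR (c' * b%:R))).-1.
have LE : L.+1 = Num.truncn (expR (c' * b%:R)) by rewrite prednK.
have q_returns x : ~ (~` E b) x -> exists2 j, (j <= L)%N &
    forall i, (i < b)%N -> ~ W (iter i f x) ->
      q (iter i f x) = q (iter (i + j.+1) f x).
  move=> /contrapT/return_time_leP[[|j] [//]] _ jE xj; exists j.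
    by rewrite -ltnS LE truncn_gt_nat.
  by move=> i ib Wi; apply: q_stable => //; rewrite iterD; exact: xj.
have lnL : ln L.+1%:R / b%:R <= c'.
  rewrite ler_pdivrMr ?ltr0n// -[leRHS]expRK ler_ln ?posrE ?expR_gt0// LE.
  by rewrite truncn_le expR_ge0.
have rate : ln L.+1%:R / b%:R - ln (1 - theta) + 2 * eta * ln (M / theta) < h.
  by rewrite /theta subKr expRK; move: lnL etaK; rewrite /c' /delta; lra.
have mEC : measurable (~` E b : set (borel X)) by exact: measurableC.
move: rate; set r := (X in X < h) => rate.
have [c'' /andP[rate_c'' c''h]] : exists c'', r < c'' < h.
  by exists ((r + h) / 2); rewrite !midf_lt.
have := codable_ge _ (codable_of_returns mf finv ferg b0 theta0 theta1 mW mEC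
  Weta Eb q_returns q_det rate_c'').
by rewrite leNgt c''h.
Qed.

End return_time_rates.

(** * Limits of extended reals and continuous potentials *)

Section extended_limits.
Context {R : realType}.

Lemma limn_esup_le_near (u : nat -> \bar R) (b : \bar R) :
  (\forall n \near \oo, (u n <= b)%E) -> (limn_esup u <= b)%E.
Proof.
move=> [N _ uN]; apply: le_trans (_ : ereal_sup (u @` [set n | (N <= n)%N]) <= _)%E.
  by apply: ereal_inf_lbound; exists [set n | (N <= n)%N] => //; exists N.
by apply: ge_ereal_sup => _ [n Nn <-]; exact: uN.
Qed.

Lemma limn_esup_ge_frequently (u : nat -> \bar R) (a : \bar R) :
  ~ (\forall n \near \oo, ~ (a <= u n)%E) -> (a <= limn_esup u)%E.
Proof.
move=> au; apply: le_ereal_inf_tmp => _ [V [N _ NV] <-].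
apply: contrapT => supV; apply: au; exists N => // n Nn an; apply: supV.
by apply: le_trans an _; apply: ereal_sup_ubound; exists n => //; exact: NV.
Qed.

Lemma cvge_of_between (I : Type) (F : set_system I) (FF : Filter F)
    (u : I -> \bar R) (l : \bar R) :
  (forall a, (a%:E < l)%E -> \forall x \near F, (a%:E <= u x)%E) ->
  (forall b, (l < b%:E)%E -> \forall x \near F, (u x <= b%:E)%E) ->
  u @ F --> l.
Proof.
case: l => [l| |] lo up; last 2 first.
- by apply/cvgeyPge => a; apply: lo; exact: ltry.
- by apply/cvgeNyPle => b; apply: up; exact: ltNyr.
have near_l e : 0 < e -> \forall x \near F, ((l - e)%:E <= u x <= (l + e)%:E)%E.
  move=> e0; have lo_e : ((l - e)%:E < l%:E)%E by rewrite lte_fin gtrBl.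
  have up_e : (l%:E < (l + e)%:E)%E by rewrite lte_fin ltrDl.
  by apply: filterS2 (lo _ lo_e) (up _ up_e) => x -> ->.
apply: cvg_EFin.
  apply: filterS (near_l 1 ltr01) => x /andP[]; case: (u x) => //.
apply/cvgrPdist_le => e e0; apply: filterS (near_l e e0) => x /=.
by case: (u x) => [r| |] /andP[]//; rewrite !lee_fin ler_distlC => -> ->.
Qed.

Lemma rat_gt_between (l : \bar R) (c : R) : (l < c%:E)%E ->
  exists q : rat, (l < (ratr q)%:E)%E /\ ratr q < c.
Proof.
case: l => [l| |]// lc.
  have [q] := @rat_in_itvoo R l c lc; rewrite in_itv /= => /andP[lq qc].
  by exists q; rewrite lte_fin.
have [|q] := @rat_in_itvoo R (c - 1) c; first by rewrite gtrBl.
by rewrite in_itv /= => /andP[_ qc]; exists q; rewrite ltNyr.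
Qed.

Lemma rat_lt_between (l : \bar R) (c : R) : (c%:E < l)%E ->
  exists q : rat, ((ratr q)%:E < l)%E /\ c < ratr q.
Proof.
move=> cl; have : (- l < (- c)%:E)%E by rewrite EFinN lteN2.
move=> /rat_gt_between[q [lq qc]]; exists (- q); rewrite rmorphN /=.
by rewrite EFinN lteNl ltrNr.
Qed.

End extended_limits.

(** Enumerate [Q] by [unpickle], with a trivial condition at the numbers that
    code nothing. *)
Lemma ae_forall_count {d} {T : measurableType d} {R : realType}
    (mu : probability T R) (Q : countType) (P : Q -> T -> Prop) :
  (forall q, {ae mu, forall x, P q x}) -> {ae mu, forall x, forall q, P q x}.
Proof.
move=> aeP.
suff : {ae mu, forall x, forall n, if unpickle n is Some q then P q x else True}.
  by apply: filterS => x Px q; have := Px (pickle q); rewrite pickleK.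
by apply: ae_foralln => n; case: unpickle => [q|]; [exact: aeP|exact: aeW].
Qed.

Section potentials.
Context {R : realType} {X : pointedMetricType R}.
Hypothesis X_compact : compact [set: X].
Variable phi : X -> R.
Hypothesis phi_continuous : continuous phi.

Lemma measurable_continuous : measurable_fun [set: borel X] (phi : borel X -> R).
Proof.
apply: (measurability _ (RGenOpens.measurableE R)) => _ [_ [a [b ->] <-]].
rewrite setTI; apply: measurable_open; move/continuousP: phi_continuous; apply.
exact: interval_open.
Qed.

Lemma continuous_bounded : exists M : R, forall x, `|phi x| <= M.
Proof.
have /compact_bounded[M [_ HM]] : compact (phi @` [set: X]).
  by apply: continuous_compact => //; exact: continuous_subspaceT.
exists (M + 1) => x; apply: HM; first by rewrite ltrDl.
by exists x.
Qed.

(** Uniform continuity, as a near-covering property of the compact space *)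
Lemma near_uniform_continuity (delta : R) : 0 < delta ->
  \forall e \near (0 : R)^'+, forall x y, mdist x y < e -> phi y <= phi x + delta.
Proof.
move=> d0; have d2 : 0 < delta / 2 by rewrite divr_gt0.
have cover := (compact_near_coveringP _).1 X_compact.
suff near_e : \forall e \near (0 : R)^'+, [set: X] `<=`
    [set x | forall y, mdist x y < e -> phi y <= phi x + delta].
  by apply: filterS near_e => e He x; exact: He.
apply: cover => x _.
have : \forall y \near x, `|phi x - phi y| < delta / 2.
  by have /cvgrPdist_lt := @phi_continuous x; apply.
move=> /nbhs_ballP[r /= r0 xr].
have r2 : 0 < r / 2 by rewrite divr_gt0.
exists (ball x (r / 2), [set e | e < r / 2]) => /=.
  split; first exact: nbhsx_ballx.
  by exists (r / 2) => //= e; rewrite /= sub0r normrN => /ltr_normlW.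
move=> [x' e] /= [xx' er] y x'y.
have xy : ball x r y.
  rewrite [r]splitr; apply: ball_triangle xx' _; rewrite ballEmdist /=.
  exact: lt_trans er.
have xx'r : ball x r x'.
  by apply: le_ball xx'; rewrite ler_pdivrMr// ler_pMr// ler1n.
have := xr _ xy; have := xr _ xx'r; rewrite !ltr_distlC => /andP[h1 h2] /andP[h3 h4].
move: h1 h2 h3 h4; lra.
Qed.

End potentials.

(** * The pressure formula *)

Section normalized_logarithm.
Context {R : realType}.

Let lne_expR_mul n s c :
  lne (expeR (s * n%:R)%:E * (expR (c * n%:R))%:E)%E = ((s + c) * n%:R)%:E :> \bar R.
Proof.
rewrite /expeR -EFinM -expRD -mulrDl lne_EFin ?expR_gt0//.
by rewrite expRK.
Qed.

Let mulVn n (a : R) : (0 < n)%N -> ((n%:R^-1)%:E * (a * n%:R)%:E)%E = a%:E.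
Proof.
by move=> n0; rewrite -EFinM mulrC mulfK// gt_eqF// ltr0n.
Qed.

Lemma normalized_lne_le n (s c : R) (S r : \bar R) : (0 < n)%N ->
  (S <= (s * n%:R)%:E)%E -> (0 <= r)%E -> (r <= (expR (c * n%:R))%:E)%E ->
  ((n%:R^-1)%:E * lne (expeR S * r) <= (s + c)%:E)%E.
Proof.
move=> n0 Ss r0 rc; rewrite -(mulVn (s + c) n0) -lne_expR_mul.
apply: lee_wpmul2l; first by rewrite lee_fin invr_ge0.
rewrite lee_lne ?in_itv/= ?leey ?andbT ?mule_ge0 ?expeR_ge0// ?lee_fin ?expR_ge0//.
by rewrite -lee_expeR in Ss; apply: lee_pmul => //; exact: expeR_ge0.
Qed.

Lemma normalized_lne_ge n (s c : R) (S r : \bar R) : (0 < n)%N ->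
  ((s * n%:R)%:E <= S)%E -> ((expR (c * n%:R))%:E <= r)%E ->
  ((s + c)%:E <= (n%:R^-1)%:E * lne (expeR S * r))%E.
Proof.
move=> n0 Ss rc; rewrite -(mulVn (s + c) n0) -lne_expR_mul.
have r0 : (0 <= r)%E by apply: le_trans rc; rewrite lee_fin expR_ge0.
apply: lee_wpmul2l; first by rewrite lee_fin invr_ge0.
rewrite lee_lne ?in_itv/= ?leey ?andbT ?mule_ge0 ?expeR_ge0// ?lee_fin ?expR_ge0//.
by rewrite -lee_expeR in Ss; apply: lee_pmul => //; rewrite lee_fin expR_ge0.
Qed.

End normalized_logarithm.

Lemma birkhoff_dist_eventually {d} {T : measurableType d} {R : realType}
    (mu : probability T R) (f : T -> T) (g : T -> R) (M delta : R) :
  measurable_fun [set: T] f -> invariant_measure mu f -> ergodic mu f ->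
  measurable_fun [set: T] g -> (forall x, `|g x| <= M) -> 0 < delta ->
  {ae mu, forall x, \forall n \near \oo,
    (\int[mu]_x g x - delta) * n%:R <= \sum_(j < n) g (iter j f x) <=
    (\int[mu]_x g x + delta) * n%:R}.
Proof.
move=> mf finv ferg mg gM d0.
have ub := birkhoff_eventually mf finv ferg mg gM (c := \int[mu]_x g x + delta).
have mNg : measurable_fun [set: T] (fun x => - g x) by exact: measurable_funN.
have NgM x : `|- g x| <= M by rewrite normrN.
have lb := birkhoff_eventually mf finv ferg mNg NgM (c := - (\int[mu]_x g x - delta)).
have intN : \int[mu]_x (- g x) = - \int[mu]_x g x.
  rewrite -[RHS]mulN1r -RintegralZl//; last exact: (integrable_bounded mu mg gM).
  by apply: eq_Rintegral => x _; rewrite mulN1r.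
rewrite intN ltrN2 gtrBl ltrDl d0 in lb ub.
apply: filterS2 (ub isT) (lb isT) => x; apply: filterS2 => n -> /=.
by rewrite andbT sumrN mulNr lerN2.
Qed.

Lemma le_birkhoff_sum_sup {R : realType} {X : metricType R} (f : X -> X)
    (phi : X -> R) n x e : 0 < e ->
  ((birkhoff_sum f phi n x)%:E <=
   birkhoff_sum_sup f phi n (dynamical_ball f x n e))%E.
Proof.
move=> e0; apply: ereal_sup_ubound; exists x => // j _.
by rewrite mdistxx.
Qed.

Lemma birkhoff_sum_sup_le {R : realType} {X : metricType R} (f : X -> X)
    (phi : X -> R) n x (e delta : R) :
  (forall y z, mdist y z < e -> phi z <= phi y + delta) ->
  (birkhoff_sum_sup f phi n (dynamical_ball f x n e) <=
   (birkhoff_sum f phi n x + delta * n%:R)%:E)%E.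
Proof.
move=> unif; apply: ge_ereal_sup => _ [y xy <-]; rewrite lee_fin.
rewrite /birkhoff_sum mulr_natr -[in X in _ *+ X](card_ord n) -sumr_const -big_split.
by apply: ler_sum => j _; apply: unif; exact: xy.
Qed.

Theorem corollary2 (R : realType) (X : pointedMetricType R) (f : X -> X)
    (phi : X -> R) (mu : probability (borel X) R)
    (X_compact : compact [set: X])
    (f_continuous : continuous f) (phi_continuous : continuous phi)
    (mu_invariant : invariant_measure mu f) (mu_ergodic : ergodic mu f) :
  {ae mu, forall x : X,
    limn_esup (fun n : nat =>
      (n%:R^-1)%:E *
      lne (expeR (birkhoff_sum_sup f phi n (dynamical_ball f x n eps)) *
           return_time f n x eps))%E @[eps --> 0^'+]
    --> metric_pressure mu f phi}.
Proof.
have mf := measurable_fun_borel f_continuous.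
have mphi := measurable_continuous phi_continuous.
have ae_filter : Filter (nbhs (almost_everywhere mu)).
  exact: ae_filter_ringOfSetsType.
have [M phiM] := continuous_bounded X_compact phi_continuous.
pose I := \int[mu]_x phi x.
have IE : (\int[mu]_x (phi x)%:E)%E = I%:E.
  rewrite fineK//; apply: integrable_fin_num => //.
  exact: (integrable_bounded mu mphi phiM).
have ae_upper : {ae mu, forall x, forall qm : rat * nat,
    (metric_entropy mu f < (ratr qm.1)%:E)%E -> \forall n \near \oo,
    (return_time f n x qm.2.+1%:R^-1 <= (expR (ratr qm.1 * n%:R))%:E)%E}.
  apply: ae_forall_count => qm.
  have [hq|hq] := pselect (metric_entropy mu f < (ratr qm.1)%:E)%E; last exact: aeW.
  have e0 : 0 < qm.2.+1%:R^-1 :> R by rewrite invr_gt0.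
  have := return_time_upper X_compact f_continuous mu_invariant mu_ergodic hq e0.
  by apply: filterS => x xn _.
have ae_lower : {ae mu, forall x, forall q : rat,
    ((ratr q)%:E < metric_entropy mu f)%E -> exists2 e : R, 0 < e &
    ~ \forall n \near \oo, (return_time f n x e <= (expR (ratr q * n%:R))%:E)%E}.
  apply: ae_forall_count => q.
  have [hq|hq] := pselect ((ratr q)%:E < metric_entropy mu f)%E; last exact: aeW.
  have [e e0] := return_time_lower f_continuous mu_invariant mu_ergodic hq.
  by apply: filterS => x xe _; exists e.
have ae_birkhoff : {ae mu, forall x, forall m : nat, \forall n \near \oo,
    (I - m.+1%:R^-1) * n%:R <= birkhoff_sum f phi n x <= (I + m.+1%:R^-1) * n%:R}.
  apply: ae_foralln => m.
  by apply: birkhoff_dist_eventually mf mu_invariant mu_ergodic mphi phiM _.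
apply: filterS3 ae_upper ae_lower ae_birkhoff => x upper lower birk.
have birk_delta delta : 0 < delta -> \forall n \near \oo,
    (I - delta) * n%:R <= birkhoff_sum f phi n x <= (I + delta) * n%:R.
  move=> d0; have [m _ md] := near_infty_natSinv_lt (PosNum d0).
  have {}md := ltW (md m (leqnn m)).
  apply: filterS (birk m) => n /andP[lo up]; apply/andP; split.
    by apply: le_trans lo; rewrite ler_wpM2r// lerD2l lerN2.
  by apply: le_trans up _; rewrite ler_wpM2r// lerD2l.
apply: cvge_of_between; rewrite /metric_pressure IE => c.
  rewrite -lteBlDr// -EFinB => /rat_lt_between[q [qh cq]].
  have [e0 e00 freq] := lower q qh.
  have d0 : 0 < ratr q - (c - I) by rewrite subr_gt0.
  near=> e; apply: limn_esup_ge_frequently => nfreq; apply: freq.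
  have near0 : \forall n \near \oo, (0 < n)%N by exists 1%N.
  apply: filterS3 near0 (birk_delta _ d0) nfreq => n n0 /andP[lo _] nge.
  rewrite leNgt; apply/negP => Rgt; apply: nge.
  have -> : c = (I - (ratr q - (c - I))) + ratr q by ring.
  apply: normalized_lne_ge => //.
    by apply: le_trans (le_birkhoff_sum_sup _ _ _ _ _) => //; rewrite lee_fin.
  apply: le_trans (ltW Rgt) _; apply: return_time_le_scale.
  by apply: ltW; near: e; exact: nbhs_right_lt.
rewrite -lteBrDr// -EFinB => /rat_gt_between[q [hq qc]].
pose delta := (c - I - ratr q) / 2.
have d0 : 0 < delta by rewrite divr_gt0// subr_gt0.
have unif := near_uniform_continuity X_compact phi_continuous d0.
near=> e; have e0 : 0 < e by near: e; exact: nbhs_right_gt.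
apply: limn_esup_le_near.
have [m _ me] := near_infty_natSinv_lt (PosNum e0).
have {}me := ltW (me m (leqnn m)).
have near0 : \forall n \near \oo, (0 < n)%N by exists 1%N.
apply: filterS3 near0 (birk_delta _ d0) (upper (q, m) hq) => n n0 /andP[_ up] Rle.
have -> : c = (I + delta + delta) + ratr q by rewrite /delta; field.
apply: normalized_lne_le => //.
- apply: le_trans (birkhoff_sum_sup_le _ (delta := delta) _ _ _) _.
    by near: e.
  by rewrite lee_fin [leRHS]mulrDl lerD2r.
- exact: le_trans (return_time_ge1 _ _ _ _).
- by apply: le_trans Rle; exact: return_time_le_scale.
Unshelve. all: by end_near. Qed.
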